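(* Let $(g,\xi^0,\ldots,\xi^{k-1},\mu^0,\ldots,\mu^{k-1})$ be a solution of the Euler--Lagrange system (interior equations (I1)--(I5) and node equations (N1)--(N4), listed in the context) of the inexact trajectory planning problem with node times $0=t_0<t_1<\cdots<t_l$. Then for every $t$ in any of the open intervals $(t_s,t_{s+1})$, $s=0,\ldots,l-1$, as well as for $t\in\{0,t_l\}$, $$\mu^0(t) = -\frac{1}{\sigma^2}\operatorname{Ad}^*_{g(t)^{-1}}\left(\sum_{i=1}^{l} 1_{t\le t_i}\, d(t_i)\operatorname{Ad}^*_{g(t_i)} J^Q(\mathrm{d}_1 d(t_i))\right).$$
   Context: Setting. $G$ is a finite-dimensional Lie group with Lie algebra $\mathfrak g$ and identity $e$, acting smoothly from the left on a finite-dimensional manifold $Q$. $d:Q\times Q\to\mathbb R$ is a distance function. $Q_0,Q_{t_1},\ldots,Q_{t_l}\in Q$ are given points, $0=t_0<t_1<\cdots<t_l$ are given times, $\sigma>0$, $k\ge 1$ is an integer, and $\ell:\mathfrak g^k\to\mathbb R$ is a smooth function; $\frac{\delta\ell}{\delta\xi^r}\in\mathfrak g^*$ denotes its partial derivative in the $r$-th argument ($r=0,\dots,k-1$). $\langle\cdot,\cdot\rangle$ denotes duality pairings. $R_g$ and $L_g$ are right and left multiplication by $g$, with differentials $TR_g$, $TL_g$. Notation. $\operatorname{Ad}_g\xi=TL_gTR_{g^{-1}}\xi$; $\operatorname{ad}_\xi\eta=\frac{d}{d\varepsilon}\big|_{\varepsilon=0}\operatorname{Ad}_{\exp(\varepsilon\xi)}\eta$;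 $\operatorname{Ad}^*_g$ and $\operatorname{ad}^*_\xi$ are the linear duals: $\langle\operatorname{Ad}^*_g\mu,\eta\rangle=\langle\mu,\operatorname{Ad}_g\eta\rangle$, $\langle\operatorname{ad}^*_\xi\mu,\eta\rangle=\langle\mu,\operatorname{ad}_\xi\eta\rangle$. For $\xi\in\mathfrak g$, $q\in Q$: $\xi_Q(q)=\frac{d}{d\varepsilon}\big|_{\varepsilon=0}\exp(\varepsilon\xi)q\in T_qQ$. The cotangent lift momentum map $J^Q:T^*Q\to\mathfrak g^*$ is defined by $\langle J^Q(\alpha_q),\xi\rangle=\langle\alpha_q,\xi_Q(q)\rangle$ for all $\alpha_q\in T_q^*Q$, $\xi\in\mathfrak g$. $\mathrm{d}_1d(q_1,q_2)\in T^*_{q_1}Q$ is the differential of $d$ with respect to its first argument. $d(t_i):=d(g(t_i)Q_0,Q_{t_i})$ and $\mathrm{d}_1d(t_i):=\mathrm{d}_1d(g(t_i)Q_0,Q_{t_i})$. It is assumed that $d$ is differentiable in its first argument at the points $(g(t_i)Q_0,Q_{t_i})$ (if $d(t_i)=0$, the product $d(t_i)\,\mathrm{d}_1d(t_i)$ is read as the differential of $\tfrac12d^2$ in the first argument). $1_{a\le b}$ equals $1$ if $a\le b$ and $0$ otherwise. $\mu^r(t_s^-)=\lim_{t\uparrow t_s}\mu^r(t)$, $\mu^r(t_s^+)=\lim_{t\downarrow t_s}\mu^r(t)$; values at $t=0$ and $t=t_l$ are the corresponding one-sided limits. A solution consists of curves $g$ in $G$, $\xi^0,\ldots,\xi^{k-1}$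 in $\mathfrak g$, $\mu^0,\ldots,\mu^{k-1}$ in $\mathfrak g^*$ on $[0,t_l]$, which are $C^1$ on each open interval $(t_{i-1},t_i)$, with the one-sided limits of the $\mu^r$ at the $t_i$ existing, with $g,\xi^0,\ldots,\xi^{k-2}$ continuous on $[0,t_l]$, $g(0)=e$ and $\xi^j(0)=\xi^j_0$ prescribed for $j=0,\ldots,k-2$, satisfying on every open interval $(t_i,t_{i+1})$, $i=0,\ldots,l-1$: (I1) $\dot\mu^0+\operatorname{ad}^*_{\xi^0}\mu^0=0$; (I2) $TR_{g^{-1}}\dot g=\xi^0$; (I3) $\dot\xi^{r-1}=\xi^r$, $r=1,\ldots,k-1$; (I4) $\dot\mu^r+\mu^{r-1}-\frac{\delta\ell}{\delta\xi^{r-1}}=0$, $r=1,\ldots,k-1$; (I5) $\mu^{k-1}=\frac{\delta\ell}{\delta\xi^{k-1}}$; and at the nodes: (N1) $\mu^0(t_s^-)-\mu^0(t_s^+)+\frac{d(t_s)}{\sigma^2}J^Q(\mathrm{d}_1d(t_s))=0$, $s=1,\ldots,l-1$; (N2) $\mu^r(t_s^-)-\mu^r(t_s^+)=0$, $r=1,\ldots,k-1$, $s=1,\ldots,l-1$; (N3) $\mu^0(t_l)+\frac{d(t_l)}{\sigma^2}J^Q(\mathrm{d}_1d(t_l))=0$; (N4) $\mu^r(t_l)=0$, $r=1,\ldots,k-1$. *)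

(* Defs.v *)
From HB Require Import structures.
From mathcomp Require Import all_boot all_order all_algebra.
From mathcomp Require Import all_classical all_reals all_analysis.

Set Implicit Arguments.
Unset Strict Implicit.
Unset Printing Implicit Defensive.

Import Order.TTheory GRing.Theory Num.Theory.
Import numFieldNormedType.Exports.

Local Open Scope ring_scope.
Local Open Scope classical_set_scope.

(* [Ck k U f] is the usual notion of class C^k on the open set U when V is
   finite-dimensional, which is the only case used below. *)
Fixpoint Ck (R : realType) (V W : normedModType R) (k : nat)
    (U : set V) (f : V -> W) {struct k} : Prop :=
  match k with
  | 0 => forall x, U x -> {for x, continuous f}
  | k'.+1 => (forall x, U x -> differentiable f x) /\
             (forall v, Ck k' U (fun x => 'D_v f x))
  end.

Definition smooth_on (R : realType) (V W : normedModType R)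
    (U : set V) (f : V -> W) : Prop := forall k, Ck k U f.

(* [cmap] and [cinv] are total functions; their values outside [cdom],
   respectively outside the range [cran] below, are irrelevant. *)
Record chart (R : realType) (n : nat) (M : topologicalType) := Chart {
  cdom : set M ;
  cmap :> M -> 'rV[R]_n ;
  cinv : 'rV[R]_n -> M ;
  cdom_open : open cdom ;
  cran_open : open (cmap @` cdom) ;
  cmapK : forall p, cdom p -> cinv (cmap p) = p ;
  cmap_continuous : forall p, cdom p -> {for p, continuous cmap} ;
  cinv_continuous : forall x, (cmap @` cdom) x -> {for x, continuous cinv}
}.

Definition cran (R : realType) (n : nat) (M : topologicalType)
  (c : chart R n M) : set 'rV[R]_n := c @` cdom c.

(* A smooth structure is given by a smooth atlas indexed by the points of M,
   [chart_at p] being a chart around p. The charts [chart_at p] also serve to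
   represent tangent vectors: T_p M is 'rV[R]_n, the vectors being read in the
   chart [chart_at p]. *)
HB.mixin Record isManifold (R : realType) (n : nat) M of Topological M := {
  chart_at : M -> chart R n M ;
  mem_chart_at : forall p, cdom (chart_at p) p ;
  chart_transition : forall p q,
    smooth_on [set x | cran (chart_at p) x /\
                       cdom (chart_at q) (cinv (chart_at p) x)]
              (fun x => chart_at q (cinv (chart_at p) x)) ;
  manifold_hausdorff : hausdorff_space M ;
  manifold_second_countable : @second_countable M
}.

#[short(type="manifoldType")]
HB.structure Definition Manifold (R : realType) (n : nat) :=
  { M of Topological M & isManifold R n M }.

Definition smooth_map (R : realType) (m n : nat)
    (M : manifoldType R m) (N : manifoldType R n) (f : M -> N) : Prop :=
  continuous f /\
  forall (p : M) (q : N),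
    smooth_on [set x | cran (chart_at p) x /\
                       cdom (chart_at q) (f (cinv (chart_at p) x))]
              (fun x => chart_at q (f (cinv (chart_at p) x))).

(* f is smooth as a map on the product manifold M x N *)
Definition smooth_map2 (R : realType) (m n k : nat) (M : manifoldType R m)
    (N : manifoldType R n) (P : manifoldType R k) (f : M -> N -> P) : Prop :=
  continuous (fun z : M * N => f z.1 z.2) /\
  forall (p : M) (q : N) (r : P),
    smooth_on [set z : 'rV[R]_m * 'rV[R]_n |
                 [/\ cran (chart_at p) z.1, cran (chart_at q) z.2 &
                     cdom (chart_at r)
                       (f (cinv (chart_at p) z.1) (cinv (chart_at q) z.2))]]
              (fun z => chart_at r
                       (f (cinv (chart_at p) z.1) (cinv (chart_at q) z.2))).

(* T_p f : T_p M -> T_(f p) N *)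
Definition tmap (R : realType) (m n : nat) (M : manifoldType R m)
    (N : manifoldType R n) (f : M -> N) (p : M) (v : 'rV[R]_m) : 'rV[R]_n :=
  'd (fun x => chart_at (f p) (f (cinv (chart_at p) x))) (chart_at p p) v.

Section Curves.
Context {R : realType}.

(* velocity vector, in the tangent space at c t *)
Definition velocity (n : nat) (M : manifoldType R n) (c : R -> M) (t : R) :
  'rV[R]_n := derive1 (fun s => chart_at (c t) (c s)) t.

Definition curve_derivable (n : nat) (M : manifoldType R n) (c : R -> M)
    (t : R) : Prop :=
  {for t, continuous c} /\ derivable (fun s => chart_at (c t) (c s)) t 1.

Definition C1_curve (n : nat) (M : manifoldType R n) (a b : R) (c : R -> M) :
    Prop :=
  forall t, a < t < b -> {for t, continuous c} /\
    forall p, cdom (chart_at p) (c t) ->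
      derivable (fun s => chart_at p (c s)) t 1 /\
      {for t, continuous (derive1 (fun s => chart_at p (c s)))}.

Definition C1_on (V : normedModType R) (a b : R) (f : R -> V) : Prop :=
  forall t, a < t < b -> derivable f t 1 /\ {for t, continuous (derive1 f)}.

End Curves.

(* The dual of 'rV[R]_n is 'cV[R]_n: as for [lin1_mx], a linear form f is
   represented by the column [covector f], acting by right multiplication. *)
Definition pairing (R : realType) (n : nat) (mu : 'cV[R]_n) (v : 'rV[R]_n) : R :=
  (v *m mu) 0 0.

Definition covector (R : realType) (n : nat) (f : 'rV[R]_n -> R) : 'cV[R]_n :=
  \col_j f (delta_mx 0 j).

Lemma covectorP (R : realType) (n : nat) (f : {linear 'rV[R]_n -> R^o})
  (v : 'rV[R]_n) : pairing (covector f) v = f v.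
Proof.
rewrite /pairing mxE {2}(row_sum_delta v) linear_sum.
by apply: eq_bigr => j _; rewrite mxE linearZ.
Qed.

HB.mixin Record isLieGroup (R : realType) (n : nat) G
    of Manifold R n G & Group G := {
  lie_mul_smooth : smooth_map2 (fun g h : G => (g * h)%g) ;
  lie_inv_smooth : smooth_map (fun g : G => (g^-1)%g)
}.

#[short(type="lieGroupType")]
HB.structure Definition LieGroup (R : realType) (n : nat) :=
  { G of Manifold R n G & Group G & isLieGroup R n G }.

Section LieGroups.
Context {R : realType} {n : nat} {G : lieGroupType R n}.

(* The Lie algebra of G is the tangent space at 1%g. *)

(* the (unique) differentiable homomorphism c from R to G with c'(0) = xi *)
Definition one_parameter_subgroup (xi : 'rV[R]_n) (c : R -> G) : Prop :=
  [/\ forall s t, c (s + t) = (c s * c t)%g,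
      forall t, curve_derivable c t &
      velocity c 0 = xi].

Definition lie_exp (xi : 'rV[R]_n) : G :=
  xget (fun=> 1%g) [set c | one_parameter_subgroup xi c] 1.

Definition Ad (g : G) (xi : 'rV[R]_n) : 'rV[R]_n :=
  tmap (fun h => g * h)%g (g^-1)%g (tmap (fun h => h * g^-1)%g 1%g xi).

Definition ad (xi eta : 'rV[R]_n) : 'rV[R]_n :=
  derive1 (fun eps : R => Ad (lie_exp (eps *: xi)) eta) 0.

Definition Ad_dual (g : G) (mu : 'cV[R]_n) : 'cV[R]_n :=
  covector (fun eta => pairing mu (Ad g eta)).

Definition ad_dual (xi : 'rV[R]_n) (mu : 'cV[R]_n) : 'cV[R]_n :=
  covector (fun eta => pairing mu (ad xi eta)).

End LieGroups.

Section Actions.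
Context {R : realType} {n m : nat} {G : lieGroupType R n}
        {Q : manifoldType R m}.

Definition smooth_left_action (act : G -> Q -> Q) : Prop :=
  [/\ forall q, act 1%g q = q,
      forall g h q, act (g * h)%g q = act g (act h q) &
      smooth_map2 act].

(* the infinitesimal generator xi_Q at q *)
Definition generator (act : G -> Q -> Q) (xi : 'rV[R]_n) (q : Q) : 'rV[R]_m :=
  velocity (fun eps : R => act (lie_exp (eps *: xi)) q) 0.

(* the cotangent lift momentum map J^Q at a covector alpha based at q *)
Definition momentum (act : G -> Q -> Q) (q : Q) (alpha : 'cV[R]_m) : 'cV[R]_n :=
  covector (fun xi => pairing alpha (generator act xi q)).

End Actions.

Section Distance.
Context {R : realType} {m : nat} {Q : manifoldType R m}.

Definition is_distance (d : Q -> Q -> R) : Prop :=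
  [/\ forall x y, 0 <= d x y,
      forall x y, d x y = 0 <-> x = y,
      forall x y, d x y = d y x &
      forall x y z, d x z <= d x y + d y z].

Definition mdifferentiable (f : Q -> R) (q : Q) : Prop :=
  differentiable (fun x => f (cinv (chart_at q) x) : R^o) (chart_at q q).

Definition mdifferential (f : Q -> R) (q : Q) : 'cV[R]_m :=
  covector ('d (fun x => f (cinv (chart_at q) x) : R^o) (chart_at q q)).

Definition dist_differentiable (d : Q -> Q -> R) (q1 q2 : Q) : Prop :=
  if d q1 q2 == 0 then mdifferentiable (fun q => 2^-1 * d q q2 ^+ 2) q1
  else mdifferentiable (fun q => d q q2) q1.

(* the covector d(q1, q2) d_1 d(q1, q2) at q1, read as the differential of
   d^2 / 2 when d(q1, q2) = 0, where d itself need not be differentiable *)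
Definition dist_d1dist (d : Q -> Q -> R) (q1 q2 : Q) : 'cV[R]_m :=
  if d q1 q2 == 0 then mdifferential (fun q => 2^-1 * d q q2 ^+ 2) q1
  else d q1 q2 *: mdifferential (fun q => d q q2) q1.

End Distance.

(* the partial derivative of ell : g^k -> R in its r-th argument; a point of
   g^k is a matrix with k rows *)
Definition partial_ell (R : realType) (n k : nat) (ell : 'M[R]_(k, n) -> R)
    (r : nat) (x : 'M[R]_(k, n)) : 'cV[R]_n :=
  covector (fun eta =>
    'D_(\matrix_(i < k) ((i == r :> nat)%:R *: eta)) (ell : _ -> R^o) x).

(* (d(t_i) / sigma^2) J^Q(d_1 d(t_i)), for q = g(t_i) Q_0 and q' = Q_(t_i) *)
Definition node_force (R : realType) (n m : nat) (G : lieGroupType R n)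
    (Q : manifoldType R m) (act : G -> Q -> Q) (d : Q -> Q -> R) (sigma : R)
    (q q' : Q) : 'cV[R]_n :=
  sigma ^- 2 *: momentum act q (dist_d1dist d q q').

(* The curves xi^r and mu^r are indexed by nat; only the indices r < k are
   constrained. Likewise for t i (i <= l) and Qt i (0 < i <= l). *)
Record EL_solution (R : realType) (n m : nat) (G : lieGroupType R n)
    (Q : manifoldType R m) (act : G -> Q -> Q) (d : Q -> Q -> R)
    (k : nat) (ell : 'M[R]_(k, n) -> R) (sigma : R)
    (l : nat) (t : nat -> R) (Q0 : Q) (Qt : nat -> Q)
    (xi0 : nat -> 'rV[R]_n)
    (g : R -> G) (xi : nat -> R -> 'rV[R]_n) (mu : nat -> R -> 'cV[R]_n) :
    Prop := {
  EL_g_C1 : forall s, (s < l)%N -> C1_curve (t s) (t s.+1) g ;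
  EL_xi_C1 : forall r s, (r < k)%N -> (s < l)%N ->
    C1_on (t s) (t s.+1) (xi r) ;
  EL_mu_C1 : forall r s, (r < k)%N -> (s < l)%N ->
    C1_on (t s) (t s.+1) (mu r) ;
  EL_mu_left : forall r s, (r < k)%N -> (0 < s <= l)%N ->
    cvg (mu r x @[x --> (t s)^'-]) ;
  EL_mu_right : forall r s, (r < k)%N -> (s < l)%N ->
    cvg (mu r x @[x --> (t s)^'+]) ;
  EL_mu_start : forall r, (r < k)%N ->
    mu r (t 0%N) = lim (mu r x @[x --> (t 0%N)^'+]) ;
  EL_mu_end : forall r, (r < k)%N ->
    mu r (t l) = lim (mu r x @[x --> (t l)^'-]) ;
  EL_g_cont : {within `[t 0%N, t l], continuous g} ;
  EL_xi_cont : forall j, (j.+1 < k)%N ->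
    {within `[t 0%N, t l], continuous (xi j)} ;
  EL_g_init : g (t 0%N) = 1%g ;
  EL_xi_init : forall j, (j.+1 < k)%N -> xi j (t 0%N) = xi0 j ;
  EL_I1 : forall s x, (s < l)%N -> t s < x < t s.+1 ->
    derive1 (mu 0%N) x + ad_dual (G := G) (xi 0%N x) (mu 0%N x) = 0 ;
  EL_I2 : forall s x, (s < l)%N -> t s < x < t s.+1 ->
    tmap (fun h => h * (g x)^-1)%g (g x) (velocity g x) = xi 0%N x ;
  EL_I3 : forall r s x, (0 < r < k)%N -> (s < l)%N -> t s < x < t s.+1 ->
    derive1 (xi r.-1) x = xi r x ;
  EL_I4 : forall r s x, (0 < r < k)%N -> (s < l)%N -> t s < x < t s.+1 ->
    derive1 (mu r) x + mu r.-1 x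
      - partial_ell ell r.-1 (\matrix_(j < k) xi j x) = 0 ;
  EL_I5 : forall s x, (s < l)%N -> t s < x < t s.+1 ->
    mu k.-1 x = partial_ell ell k.-1 (\matrix_(j < k) xi j x) ;
  EL_N1 : forall s, (0 < s < l)%N ->
    lim (mu 0%N x @[x --> (t s)^'-]) - lim (mu 0%N x @[x --> (t s)^'+])
      + node_force act d sigma (act (g (t s)) Q0) (Qt s) = 0 ;
  EL_N2 : forall r s, (0 < r < k)%N -> (0 < s < l)%N ->
    lim (mu r x @[x --> (t s)^'-]) - lim (mu r x @[x --> (t s)^'+]) = 0 ;
  EL_N3 :
    mu 0%N (t l) + node_force act d sigma (act (g (t l)) Q0) (Qt l) = 0 ;
  EL_N4 : forall r, (0 < r < k)%N -> mu r (t l) = 0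
}.

(* Main.v *)
(* The pairing of mu^0(t) with Ad_{g(t)} eta is constant in t on each open
   interval between two nodes: by (I2) the derivative of Ad_{g(t)} eta is
   ad_{xi^0} (Ad_{g(t)} eta), which (I1) compensates. Its jump at a node is
   given by (N1) and its last value by (N3), whence the formula, by summation.

   Since ad is defined through the exponential map, the derivative of Ad at 1
   can be identified with ad only once every xi generates a unique
   one-parameter subgroup. Existence: a local solution of the right-invariant
   differential equation given by xi (Picard iteration in a chart) is a local
   homomorphism, extended to the real line by c(t) = c(t/N)^N. Local
   multiplicativity and uniqueness rest on the same observation: if c and d
   have the same right-invariant velocity, then c^-1 d has zero velocity. *)

Require Import Defs.
From HB Require Import structures.
From mathcomp Require Import all_boot all_order all_algebra.
From mathcomp Require Import all_classical all_reals all_analysis.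
From mathcomp Require Import zify lra ring.
Set Implicit Arguments.
Unset Strict Implicit.
Unset Printing Implicit Defensive.
Import Order.TTheory GRing.Theory Num.Theory.
Import numFieldNormedType.Exports.
Local Open Scope ring_scope.
Local Open Scope classical_set_scope.

(** * Complements on derivatives *)

(** Tangent vectors are read in the chart attached to their base point, whereas a curve in [G] is
    differentiated at moving base points. Hence a calculus in which source and target charts are
    both free, and a systematic transport to the single chart at [1]. For [Ad] this transport is
    multiplicativity: it reduces continuity and derivatives at any [g] to differentiability at [1].
    That last point costs a second derivative, since [Ad g eta] is already a first derivative of the
    multiplication. Existence of one-parameter subgroups cannot be bypassed: [lie_exp] is a choice
    with default value [1], so if [xi] generated none, [lie_exp (eps *: xi)] would be constant and
    [ad xi] would vanish, whatever the derivative of [Ad] is. *)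

Section DifferentialComplements.
Context {R : realType}.

Lemma near_eq_is_diff (V W : normedModType R) (f g : V -> W) (x : V) :
  {near x, f =1 g} -> differentiable f x -> is_diff x g ('d f x).
Proof.
move=> fg df; have fgx := nbhs_singleton fg.
have dfc : continuous ('d f x) by exact: diff_continuous.
have go : g \o shift x = cst (g x) + 'd f x +o_0 id.
  have /eqaddoP fo := diff_locally df.
  apply/eqaddoP => e e0; move: (fo e e0); apply: filter_app.
  have : \forall y \near (0 : V), f (y + x) = g (y + x).
    move: fg; rewrite (near_shift 0).
    by apply: filterS => y /=; rewrite subr0.
  by apply: filterS => y fgy; rewrite /= !fctE /= fgy fgx.
have dgE : 'd g x = 'd f x :> (V -> W) by exact: diff_unique.
have dg : differentiable g x by apply/diff_locallyP; rewrite dgE; split.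
exact: DiffDef dg dgE.
Qed.

Lemma near_eq_differentiable (V W : normedModType R) (f g : V -> W) (x : V) :
  {near x, f =1 g} -> differentiable f x -> differentiable g x.
Proof. by move=> fg /(near_eq_is_diff fg) -[]. Qed.

Lemma near_eq_diff (V W : normedModType R) (f g : V -> W) (x : V) :
  {near x, f =1 g} -> differentiable f x -> 'd g x = 'd f x :> (V -> W).
Proof. by move=> fg /(near_eq_is_diff fg) -[]. Qed.

Lemma is_derive1_comp (V W : normedModType R) (c : R -> V) (F : V -> W)
    (s : R) (v : V) :
  is_derive s 1 c v -> differentiable F (c s) ->
  is_derive s 1 (F \o c) ('d F (c s) v).
Proof.
move=> [dc <-] dF; have /derivable1_diffP dc' := dc.
have dFc : differentiable (F \o c) s by exact: differentiable_comp.
split; first exact/derivable1_diffP.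
by rewrite !deriveE// diff_comp.
Qed.

Lemma is_derive_continuous (V : normedModType R) (c : R -> V) (s : R) v :
  is_derive s 1 c v -> {for s, continuous c}.
Proof.
by move=> [dc _]; apply: differentiable_continuous; apply/derivable1_diffP.
Qed.

Lemma is_derive1_unique (V : normedModType R) (c : R -> V) (s : R) v w :
  is_derive s 1 c v -> is_derive s 1 c w -> v = w.
Proof. by move=> [_ <-] [_ <-]. Qed.

Lemma is_derive1_addr (V : normedModType R) (c : R -> V) (s b : R) v :
  is_derive (s + b) 1 c v -> is_derive s 1 (fun x => c (x + b)) v.
Proof.
move=> dc.
have db : is_derive s 1 (shift b : R -> R) 1 by exact: is_derive_shift.
have dcd : differentiable c (shift b s) by apply/derivable1_diffP; case: dc.
have := is_derive1_comp db dcd; suff -> : 'd c (shift b s) 1 = v by [].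
by rewrite -deriveE//; case: dc.
Qed.

Lemma is_derive1_scale (V : normedModType R) (c : R -> V) (s b : R) v :
  is_derive (b * s) 1 c v -> is_derive s 1 (fun x => c (b * x)) (b *: v).
Proof.
move=> dc.
have db : is_derive s 1 (fun x : R => b * x) b.
  have := @is_deriveZ R R R id b s 1 1 _.
  by rewrite /GRing.scale /= mulr1; apply.
have dcd : differentiable c (b * s) by apply/derivable1_diffP; case: dc.
have := is_derive1_comp db dcd; suff -> : 'd c (b * s) b = b *: v by [].
by rewrite -[X in 'd c _ X]mulr1 [LHS]linearZ /= -deriveE//; case: dc => _ ->.
Qed.

Lemma is_derive_mxP (m n : nat) (c : R -> 'M[R]_(m, n)) (s : R) v :
  is_derive s 1 c v <-> forall i j, is_derive s 1 (fun x => c x i j) (v i j).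
Proof.
split=> [[dc <-] i j|dc].
  split; first exact: (derivable_mxP _ _ _).1.
  by rewrite derive_mx// mxE.
have dc' : derivable c s 1 by apply/derivable_mxP => i j; case: (dc i j).
split=> //; rewrite derive_mx//; apply/matrixP => i j.
by rewrite mxE; case: (dc i j).
Qed.

(** Expanding [f y] in the canonical basis reduces the claim to products of real functions. *)
Lemma differentiable_scale (V : normedModType R) m (k : V -> R)
    (f : V -> 'rV[R]_m) (x : V) :
  differentiable k x -> differentiable f x ->
  differentiable (fun y => k y *: f y) x.
Proof.
move=> dk df.
rewrite (_ : (fun _ => _) =
    \sum_(i < m) (fun y => (k y * f y 0 i) *: delta_mx 0 i)); last first.
  apply/funext => y; rewrite fct_sumE [in LHS](row_sum_delta (f y)).
  by rewrite scaler_sumr; apply: eq_bigr => i _; rewrite scalerA.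
apply: differentiable_sum => i; apply: differentiableZl.
apply: differentiableM => //.
exact: (differentiable_comp df (differentiable_coord (f x) 0 i)).
Qed.

Lemma is_diff_pair_cstl (V W : normedModType R) (a : V) (y : W) :
  is_diff y (fun y => (a, y)) (fun v => (0, v)).
Proof.
by have := @is_diff_pair _ _ _ _ (cst a) 0 id id y _ _; apply.
Qed.

Lemma is_diff_pair_cstr (V W : normedModType R) (a : V) (y : W) :
  is_diff y (fun y => (y, a)) (fun v => (v, 0)).
Proof.
by have := @is_diff_pair _ _ _ _ id id (cst a) 0 y _ _; apply.
Qed.

End DifferentialComplements.

Lemma is_derive0_itvoo_constant (R : realType) (f : R -> R) (a b : R) :
  (forall s, a < s < b -> is_derive s 1 f 0) ->
  forall s u, a < s < b -> a < u < b -> f s = f u.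
Proof.
move=> df.
have lt s u : a < s < b -> a < u < b -> s <= u -> f s = f u.
  move=> /andP[as_ sb] /andP[au ub] su.
  have der x : s <= x <= u -> is_derive x 1 f 0.
    by move=> /andP[sx xu]; apply: df; rewrite (lt_le_trans as_ sx) (le_lt_trans xu ub).
  have [||c _] := @MVT_segment _ f (cst 0) _ _ su.
  - by move=> x; rewrite in_itv/= => /andP[/ltW sx /ltW xu]; apply/der/andP.
  - apply: derivable_within_continuous => x; rewrite in_itv/= => sxu.
    by case: (der _ sxu).
  by rewrite mul0r => /eqP; rewrite subr_eq0 eq_sym => /eqP.
move=> s u ss uu; have [su|/ltW us] := leP s u; first exact: lt.
by apply/esym/lt.
Qed.

Lemma within_itvcc_left (R : realType) (T : topologicalType) (f : R -> T)
    (a b x : R) :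
  {within `[a, b], continuous f} -> a < x <= b -> f y @[y --> x^'-] --> f x.
Proof.
move=> fc /andP[ax xb] B fB.
have := (subspace_continuousP `[a, b]%classic f).1 fc x.
rewrite /= in_itv /= (ltW ax) xb => /(_ isT B fB) nB.
suff : \forall y \near x, y < x -> B (f y) by [].
apply: filterS2 (lt_nbhsr ax) nB => y ay yB yx; apply: yB.
by rewrite /= in_itv/= (ltW ay) (le_trans (ltW yx) xb).
Qed.

Lemma within_itvcc_right (R : realType) (T : topologicalType) (f : R -> T)
    (a b x : R) :
  {within `[a, b], continuous f} -> a <= x < b -> f y @[y --> x^'+] --> f x.
Proof.
move=> fc /andP[ax xb] B fB.
have := (subspace_continuousP `[a, b]%classic f).1 fc x.
rewrite /= in_itv /= ax (ltW xb) => /(_ isT B fB) nB.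
suff : \forall y \near x, x < y -> B (f y) by [].
apply: filterS2 (lt_nbhsl xb) nB => y yb yB xy; apply: yB.
by rewrite /= in_itv/= (le_trans ax (ltW xy)) ltW.
Qed.

Section MatrixNorm.
Context {R : realType}.

Lemma mx_norm_le (m n : nat) (A : 'M[R]_(m, n)) (b : R) :
  0 <= b -> (forall i j, `|A i j| <= b) -> `|A| <= b.
Proof.
move=> b0 Ab; rewrite [leLHS]/Num.Def.normr/= mx_normrE.
by apply: bigmax_le => // -[i j] _; exact: Ab.
Qed.

Lemma mx_norm_ge (m n : nat) (A : 'M[R]_(m, n)) i j : `|A i j| <= `|A|.
Proof.
rewrite [leRHS]/Num.Def.normr/= mx_normrE.
by apply: le_trans; last exact: (le_bigmax _ _ (i, j)).
Qed.

(** The mean value theorem fails for vector values, but it applies to each entry; the norm being the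
    maximum of the entries, the bound [B] survives unchanged. *)
Lemma mx_norm_MVT (m n : nat) (f df : R -> 'M[R]_(m, n)) (a b B : R) :
  0 <= B -> (forall s, a <= s <= b -> is_derive s 1 f (df s)) ->
  (forall s, a <= s <= b -> `|df s| <= B) ->
  forall s u, a <= s <= b -> a <= u <= b -> `|f u - f s| <= B * `|u - s|.
Proof.
move=> B0 fdf dfB.
have lt s u : a <= s <= b -> a <= u <= b -> s <= u ->
    `|f u - f s| <= B * `|u - s|.
  move=> /andP[as_ sb] /andP[au ub] su.
  apply: mx_norm_le => [|i j]; first exact: mulr_ge0.
  have der x : s <= x <= u ->
      is_derive x 1 (fun y => f y i j) (df x i j).
    move=> /andP[sx xu]; apply: (is_derive_mxP _ _ _).1.
    by apply: fdf; rewrite (le_trans as_ sx) (le_trans xu ub).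
  have [||c] := @MVT_segment _ (fun y => f y i j) (fun y => df y i j) _ _ su.
  - by move=> x; rewrite in_itv/= => /andP[/ltW sx /ltW xu]; apply/der/andP.
  - apply: derivable_within_continuous => x; rewrite in_itv/= => sxu.
    by case: (der _ sxu).
  rewrite in_itv/= => /andP[sc cu] E.
  rewrite !mxE E normrM ler_wpM2r// (le_trans (mx_norm_ge _ _ _))//.
  by apply: dfB; rewrite (le_trans as_ sc) (le_trans cu ub).
move=> s u ss uu; have [su|/ltW us] := leP s u; first exact: lt.
by rewrite distrC [`|u - s|]distrC; exact: lt.
Qed.

End MatrixNorm.

(** * Ordinary differential equations *)

Section Picard.
Context {R : realType}.

Lemma continuous_ex_primitive (f : R -> R) : continuous f ->
  exists F : R -> R, F 0 = 0 /\ forall x : R, `|x| < 1 -> is_derive x 1 F (f x).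
Proof.
move=> cf.
(* The integral starts at [-1], so that [0] is interior and [F] has a two-sided derivative there;
   subtracting [F 0] restores the initial value. *)
pose F x := (\int[lebesgue_measure]_(t in `[-1, x]) f t)%R.
exists (fun x => F x - F 0); split; first by rewrite subrr.
move=> x; rewrite ltr_norml => /andP[x1 x2].
have fi : lebesgue_measure.-integrable `[-1, 1] (EFin \o f).
  apply: continuous_compact_integrable; first exact: segment_compact.
  exact: continuous_subspaceT.
have [dF F'x] := continuous_FTC1_closed x2 fi x1 (cf x).
have dFx : is_derive x 1 F (f x) by split; [exact: dF|rewrite -derive1E].
by have := is_deriveB dFx (is_derive_cst (F 0) x 1); rewrite subr0.
Qed.

Lemma continuous_ex_primitive_rV n (f : R -> 'rV[R]_n) (a : 'rV[R]_n) :
  continuous f -> exists F : R -> 'rV[R]_n,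
    F 0 = a /\ forall x : R, `|x| < 1 -> is_derive x 1 F (f x).
Proof.
move=> cf.
have /choice[F FP] j : exists F : R -> R,
    F 0 = 0 /\ forall x : R, `|x| < 1 -> is_derive x 1 F (f x 0 j).
  apply: continuous_ex_primitive => x.
  exact: (@continuous_comp _ _ _ f (fun v : 'rV[R]_n => v 0 j) x (cf x)
    (@coord_continuous R 1 n 0 j (f x))).
exists (fun x => \row_j (a 0 j + F j x)); split.
  by apply/rowP => j; rewrite mxE (FP j).1 addr0.
move=> x x1; apply/is_derive_mxP => i j; rewrite ord1.
rewrite (_ : (fun _ => _) = cst (a 0 j) + F j); last first.
  by apply/funext => y; rewrite mxE.
rewrite -[f x 0 j]add0r; apply: is_deriveD; exact: (FP j).2.
Qed.

Variables (n : nat) (X : 'rV[R]_n -> 'rV[R]_n) (a : 'rV[R]_n) (r M L : R).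
Hypothesis r_gt0 : 0 < r.
Hypothesis X_cont : forall y, `|y - a| <= r -> {for y, continuous X}.
Hypothesis X_bound : forall y, `|y - a| <= r -> `|X y| <= M.
Hypothesis L_ge0 : 0 <= L.
Hypothesis X_lip : forall y z, `|y - a| <= r -> `|z - a| <= r ->
  `|X y - X z| <= L * `|y - z|.

Let M_ge0 : 0 <= M.
Proof.
by apply: le_trans (normr_ge0 (X a)) (X_bound _); rewrite subrr normr0 ltW.
Qed.

(** The three bounds serve in turn to stay where primitives are available, to keep Picard's iterates
    in the ball of radius [r], and to make the iteration contract by one half. Adding 1 to [M] and
    [L] avoids dividing by zero. *)
Let ex_delta : exists2 delta : R, 0 < delta &
  [/\ delta < 1, M * delta <= r & L * delta <= 2^-1].
Proof.
have M1 : 0 < M + 1 by rewrite ltr_wpDl.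
have L1 : 0 < L + 1 by rewrite ltr_wpDl.
pose m := Num.min (r / (M + 1)) (2^-1 / (L + 1)).
exists (Num.min 2^-1 m).
  by rewrite !lt_min invr_gt0 ltr0n !divr_gt0// invr_gt0.
have e1 : Num.min 2^-1 m <= 2^-1 by rewrite ge_min lexx.
have e2 : Num.min 2^-1 m <= r / (M + 1) by rewrite !ge_min lexx orbT.
have e3 : Num.min 2^-1 m <= 2^-1 / (L + 1) by rewrite !ge_min lexx !orbT.
split; first by apply: le_lt_trans e1 _; lra.
- apply: le_trans (ler_wpM2l M_ge0 e2) _.
  by rewrite mulrCA ler_piMr ?(ltW r_gt0)// ler_pdivrMr// mul1r lerDl.
- apply: le_trans (ler_wpM2l L_ge0 e3) _.
  by rewrite mulrCA ler_piMr// ler_pdivrMr// mul1r lerDl.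
Qed.

Lemma picard_local_solution : exists2 delta : R, 0 < delta &
  exists c : R -> 'rV[R]_n, c 0 = a /\
    forall t : R, `|t| < delta -> `|c t - a| <= r /\ is_derive t 1 c (X (c t)).
Proof.
have [delta d0 [d1 Md Ld]] := ex_delta.
exists delta => //.
(* Picard's iteration only uses the values of a curve on [-delta, delta];
   clamping the time keeps all the curves continuous on the whole line. *)
pose clamp (t : R) := Num.max (- delta) (Num.min t delta).
have clampE t : `|t| <= delta -> clamp t = t.
  by rewrite ler_norml => /andP[t1 t2]; rewrite /clamp min_l// max_r.
have clamp_le t : `|clamp t| <= delta.
  rewrite ler_norml /clamp le_max lexx/= ge_max ge_min lexx orbT andbT.
  by rewrite (le_trans _ (ltW d0))// oppr_le0 ltW.
have clamp_cont : continuous clamp.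
  move=> t; apply: (@continuous_max _ _ (cst (- delta)) (fun t => Num.min t delta)).
    exact: cst_continuous.
  apply: (@continuous_min _ _ id (cst delta)); first by [].
  exact: cst_continuous.
pose good (y : R -> 'rV[R]_n) := continuous (y \o clamp) /\
  forall t, `|t| <= delta -> `|y t - a| <= r.
(* [Phi] is Picard's operator, the primitive of [X \o y] with value [a] at 0. It is specified on
   good curves only. *)
have /choice[Phi PhiP] (y : R -> 'rV[R]_n) : exists z : R -> 'rV[R]_n,
    good y -> z 0 = a /\ forall t : R, `|t| < 1 -> is_derive t 1 z (X (y (clamp t))).
  have [[cy yr]|ng] := pselect (good y); last by exists y.
  have cXy : continuous (X \o (y \o clamp)).
    move=> t; apply: continuous_comp; first exact: cy.
    by apply: X_cont; exact: yr.
  by have [z zP] := continuous_ex_primitive_rV a cXy; exists z.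
have mem_seg t : `|t| <= delta -> - delta <= t <= delta by rewrite ler_norml.
have mem0 : - delta <= 0 <= delta by rewrite oppr_le0 ltW.
have Phi_good y : good y -> good (Phi y).
  move=> gy; have [Phi0 dPhi] := PhiP _ gy; split=> [t|t td].
    apply: continuous_comp; first exact: clamp_cont.
    have tc : `|clamp t| < 1 by exact: le_lt_trans (clamp_le t) d1.
    by apply: is_derive_continuous; exact: dPhi.
  rewrite -Phi0; apply: (@le_trans _ _ (M * `|t - 0|)).
    apply: (mx_norm_MVT M_ge0 _ _ mem0 (mem_seg _ td)) => s.
      rewrite -ler_norml => sd; apply: dPhi; exact: le_lt_trans sd d1.
    by move=> _; apply: X_bound; apply: gy.2.
  by rewrite subr0; apply: le_trans Md; rewrite ler_wpM2l.
have Phi_contr y z B : good y -> good z -> 0 <= B ->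
    (forall t, `|t| <= delta -> `|y t - z t| <= B) ->
    forall t, `|t| <= delta -> `|Phi y t - Phi z t| <= B / 2.
  move=> gy gz B0 yzB t td.
  have [y0 dy] := PhiP _ gy; have [z0 dz] := PhiP _ gz.
  have LB : 0 <= L * B by exact: mulr_ge0.
  have := @mx_norm_MVT _ _ _ (Phi y - Phi z)
    (fun t => X (y (clamp t)) - X (z (clamp t))) _ _ _ LB _ _ 0 t
    mem0 (mem_seg _ td).
  rewrite /= !fctE y0 z0 subrr !subr0 => /(_ _ _)/le_trans; apply.
  - move=> s; rewrite -ler_norml => sd.
    have s1 : `|s| < 1 by exact: le_lt_trans sd d1.
    by apply: is_deriveB; [exact: dy|exact: dz].
  - move=> s; rewrite -ler_norml => sd.
    apply: le_trans (X_lip _ _) _; [exact: gy.2|exact: gz.2|].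
    by apply: ler_wpM2l => //; exact: yzB.
  - rewrite mulrAC [leRHS]mulrC ler_wpM2r//.
    by apply: le_trans Ld; rewrite ler_wpM2l.
pose u k := iter k Phi (cst a).
have gu k : good (u k).
  elim: k => [|k IH]; last exact: Phi_good.
  split=> [t|t _]; first exact: cst_continuous.
  by rewrite /u/= subrr normr0 ltW.
(* The first step is at most [r], which is [e 0 / 2], and each step halves: [e k] bounds the sum of
   all steps from the [k]-th one on. *)
pose e (k : nat) : R := (2 * r) * 2^-1 ^+ k.
have e_ge0 k : 0 <= e k by rewrite mulr_ge0// ?exprn_ge0// mulr_ge0// ltW.
have eS k : e k.+1 = e k / 2 by rewrite /e exprSr mulrA.
have e_cvg : e k @[k --> \oo] --> (0 : R).
  by apply: cvg_geometric; rewrite ger0_norm; lra.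
have e_small (z b : R) : (forall k, z <= e k + b) -> z <= b.
  move=> ze; have eb : e k + b @[k --> \oo] --> 0 + b.
    by apply: cvgD => //; exact: cvg_cst.
  rewrite -[b]add0r; apply: (ler_cvg_to (cvg_cst z) eb).
  by apply: nearW => k; exact: ze.
have uS k t : `|t| <= delta -> `|u k.+1 t - u k t| <= e k / 2.
  elim: k t => [|k IH] t td.
    rewrite /e expr0 mulr1 mulrAC divff// mul1r.
    exact: (gu 1%N).2.
  rewrite eS; apply: (Phi_contr (u k.+1) (u k)) => //.
  exact: divr_ge0.
have u_dist k j t : `|t| <= delta -> `|u (k + j)%N t - u k t| <= e k - e (k + j)%N.
  move=> td; elim: j => [|j IH]; first by rewrite addn0 !subrr normr0.
  rewrite addnS -(subrKA (u (k + j)%N t)).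
  apply: le_trans (ler_normD _ _) _.
  have := uS (k + j)%N t td; have := eS (k + j)%N; move: IH; lra.
have u_dist' k j t : `|t| <= delta -> `|u (k + j)%N t - u k t| <= e k.
  move=> td; apply: le_trans (u_dist k j t td) _.
  by rewrite lerBlDr lerDl.
have u_cvg t : `|t| <= delta -> cvg (u k t @[k --> \oo]).
  move=> td; apply/cauchy_cvgP/cauchy_exP => eps eps0.
  have [N _ /(_ N (leqnn N)) /= NP] : \forall k \near \oo, e k < eps.
    move/cvgrPdist_lt : e_cvg => /(_ _ eps0); apply: filterS => k.
    by rewrite sub0r normrN ger0_norm.
  exists (u N t); exists N => // k /= Nk.
  rewrite -ball_normE /= distrC -(subnKC Nk).
  exact: le_lt_trans (u_dist' _ _ _ td) NP.
pose y t := lim (u k (clamp t) @[k --> \oo]).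
have y_dist k t : `|y t - u k (clamp t)| <= e k.
  have c1 : u j (clamp t) @[j --> \oo] --> y t by exact: u_cvg.
  have c2 : `|u j (clamp t) - u k (clamp t)| @[j --> \oo] -->
      `|y t - u k (clamp t)|.
    by apply: cvg_norm; apply: cvgB => //; exact: cvg_cst.
  apply: (ler_cvg_to c2 (cvg_cst (e k))).
  exists k => // j /= kj; rewrite -(subnKC kj); exact: u_dist'.
have y_cont : continuous y.
  move=> t; apply/cvgrPdist_lt => eps eps0.
  have h : 0 < eps / 3 by rewrite divr_gt0.
  have [N _ /(_ N (leqnn N)) /= NP] : \forall k \near \oo, e k < eps / 3.
    move/cvgrPdist_lt : e_cvg => /(_ _ h); apply: filterS => k.
    by rewrite sub0r normrN ger0_norm.
  have /cvgrPdist_lt/(_ _ h) := (gu N).1 t.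
  apply: filterS => s /= us.
  have -> : y t - y s = (y t - u N (clamp t)) +
      (u N (clamp t) - u N (clamp s)) + (u N (clamp s) - y s).
    by rewrite !subrKA.
  apply: le_lt_trans (ler_normD _ _) _.
  apply: (@lt_le_trans _ _ (eps / 3 + eps / 3 + eps / 3)); last by lra.
  apply: ler_ltD; last first.
    by rewrite distrC; exact: le_lt_trans (y_dist N s) NP.
  apply: le_trans (ler_normD _ _) _; apply: lerD; last exact: ltW.
  exact: le_trans (y_dist N t) (ltW NP).
have gy : good y.
  split=> [t|t td]; first by apply: continuous_comp; [exact: clamp_cont|exact: y_cont].
  apply: e_small => k; rewrite -(subrKA (u k (clamp t))).
  apply: le_trans (ler_normD _ _) _; apply: lerD; first exact: y_dist.
  exact: (gu k).2.
(* Both [Phi y] and [y] are within [e k.+1] of the iterate [u k.+1], hence within [e k] of each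
   other, for every [k]. *)
have PhiyE t : `|t| <= delta -> Phi y t = y t.
  move=> td; apply/eqP; rewrite -subr_eq0 -normr_le0; apply: e_small => k.
  rewrite addr0 -(subrKA (u k.+1 t)); apply: le_trans (ler_normD _ _) _.
  rewrite [e k]splitr -eS; apply: lerD.
    rewrite eS; apply: (Phi_contr y (u k)) => // s sd.
    by rewrite -[in u k _](clampE s).
  by rewrite distrC -[in u _ _](clampE t).
(* The solution is [Phi y] and not [y]: as a primitive it is known to be derivable, and it agrees
   with [y] on the time interval. *)
exists (Phi y); split; first by have [] := PhiP _ gy.
move=> t td; have td' := ltW td; split; first exact: (Phi_good _ gy).2.
rewrite PhiyE// -{2}(clampE t td').
by apply: (PhiP _ gy).2; exact: lt_trans td d1.
Qed.

End Picard.

(** * Local solutions for a vector field with derivatives continuous at the initial point *)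

Section LocalSolution.
Context {R : realType} {n : nat}.
Variables (X : 'rV[R]_n -> 'rV[R]_n) (a : 'rV[R]_n).
Hypothesis X_diff : \forall y \near a, differentiable X y.
Hypothesis X_C1 : forall v, {for a, continuous ('D_v X)}.

(** Continuity of the partial derivatives at [a] bounds them nearby, and balls are convex, so [X] is
    Lipschitz on a small ball and Picard's theorem applies. *)
Lemma C1_local_solution : exists c : R -> 'rV[R]_n,
  c 0 = a /\ \forall t \near 0, is_derive (t : R) 1 c (X (c t)).
Proof.
(* [B] exceeds every partial derivative at [a] by at least 1, so it still bounds them all near
   [a]. *)
pose B := 1 + \sum_(j < n) `|'D_(delta_mx 0 j) X a|.
have B_gt0 : 0 < B by rewrite ltr_pwDl// sumr_ge0.
have nearB : \forall y \near a, forall j : 'I_n, `|'D_(delta_mx 0 j) X y| <= B.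
  pose P (j : 'I_n) y := `|'D_(delta_mx 0 j) X y| <= B.
  apply: (@filter_forall _ _ P (nbhs a) _) => j.
  have /cvgr_norm_le := @X_C1 (delta_mx 0 j); apply.
  by rewrite /B (bigD1 j)//= addrCA ltrDl ltr_pwDl// sumr_ge0.
have nearM : \forall y \near a, `|X y| <= `|X a| + 1.
  have /cvgr_norm_le : {for a, continuous X}.
    by apply: differentiable_continuous; exact: nbhs_singleton X_diff.
  by apply; rewrite ltrDl.
have : \forall y \near a, differentiable X y /\
    (forall j : 'I_n, `|'D_(delta_mx 0 j) X y| <= B) /\ `|X y| <= `|X a| + 1.
  by apply: filterI => //; exact: filterI.
move=> /nbhs_ballP[r0 /= r0_gt0 ball_r0].
pose r := r0 / 2.
have r_gt0 : 0 < r by rewrite divr_gt0.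
have inr y : `|y - a| <= r -> differentiable X y /\
    (forall j : 'I_n, `|'D_(delta_mx 0 j) X y| <= B) /\ `|X y| <= `|X a| + 1.
  move=> yr; apply: ball_r0; rewrite -ball_normE /= distrC.
  by apply: le_lt_trans yr _; rewrite /r; lra.
have dXB y v : `|y - a| <= r -> `|'d X y v| <= (n%:R * B) * `|v|.
  move=> /inr[dX [DX _]].
  rewrite {1}(row_sum_delta v) linear_sum.
  apply: le_trans (ler_norm_sum _ _ _) _.
  rewrite -mulrA -[n in n%:R]card_ord mulr_natl -sumr_const.
  apply: ler_sum => j _; rewrite linearZ /= normrZ mulrC.
  apply: ler_pM => //; last exact: mx_norm_ge.
  by have := DX j; rewrite deriveE.
have L_ge0 : 0 <= n%:R * B by rewrite mulr_ge0// ltW.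
have lipX y z : `|y - a| <= r -> `|z - a| <= r ->
    `|X y - X z| <= (n%:R * B) * `|y - z|.
  move=> yr zr.
  (* The segment from [z] to [y] stays in the ball; the mean value inequality along it gives the
     Lipschitz bound. *)
  pose f s := z + s *: (y - z).
  have fr s : 0 <= s <= 1 -> `|f s - a| <= r.
    move=> /andP[s0 s1].
    have -> : f s - a = (1 - s) *: (z - a) + s *: (y - a).
      rewrite /f !scalerBr !scalerBl !scale1r.
      by apply/rowP => j; rewrite !mxE; ring.
    apply: le_trans (ler_normD _ _) _; rewrite !normrZ !ger0_norm ?subr_ge0//.
    have -> : r = (1 - s) * r + s * r by ring.
    by apply: lerD; apply: ler_wpM2l => //; rewrite subr_ge0.
  have df s : is_derive (s : R) 1 f (y - z).
    have [dl dlE] : is_diff s ( *:%R ^~ (y - z)) ( *:%R ^~ (y - z)).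
      exact: is_diff_scalel.
    rewrite -[y - z in X in is_derive _ _ _ X]add0r.
    apply: is_deriveD; split; first exact/derivable1_diffP.
    by rewrite deriveE// dlE scale1r.
  have := @mx_norm_MVT R 1 n (X \o f) (fun s => 'd X (f s) (y - z)) 0 1
    (n%:R * B * `|y - z|) (mulr_ge0 L_ge0 (normr_ge0 _)) _ _ 0 1.
  have f1 : f 1 = y by rewrite /f scale1r addrC subrK.
  have f0 : f 0 = z by rewrite /f scale0r addr0.
  rewrite lexx ler01 /= subr0 normr1 mulr1 f1 f0.
  apply=> // s sI.
    apply: is_derive1_comp (df s) _.
    by have [] := inr _ (fr s sI).
  by apply: dXB; exact: fr.
have [delta d0 [c [c0 cP]]] := @picard_local_solution R n X a r (`|X a| + 1)
  (n%:R * B) r_gt0 (fun y yr => differentiable_continuous (inr y yr).1)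
  (fun y yr => (inr y yr).2.2) L_ge0 lipX.
exists c; split => //; apply/nbhs_ballP; exists delta => //= t.
by rewrite -ball_normE /= sub0r normrN => /cP[].
Qed.

End LocalSolution.

(** * Maps between manifolds *)

Section ManifoldMaps.
Context {R : realType}.

(* The expression of [f] in the charts [chart_at p] and [chart_at q]. *)
Definition loc (m n : nat) (M : manifoldType R m) (N : manifoldType R n)
    (p : M) (q : N) (f : M -> N) (x : 'rV[R]_m) : 'rV[R]_n :=
  chart_at q (f (cinv (chart_at p) x)).

(** All pairs of charts around [x] and [f x] are allowed, so that composites can be read through any
    intermediate chart. Continuity is required separately because charts are total functions with
    arbitrary values off their domains. *)
Definition mdiff_at (m n : nat) (M : manifoldType R m) (N : manifoldType R n)
    (f : M -> N) (x : M) : Prop :=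
  {for x, continuous f} /\ forall p q, cdom (chart_at p) x ->
    cdom (chart_at q) (f x) -> differentiable (loc p q f) (chart_at p x).

(** The tangent map with both charts free; [tmap f x] is the case [p = x], [q = f x]. *)
Definition tloc (m n : nat) (M : manifoldType R m) (N : manifoldType R n)
    (p : M) (q : N) (f : M -> N) (x : M) (v : 'rV[R]_m) : 'rV[R]_n :=
  'd (loc p q f) (chart_at p x) v.

Section OneManifold.
Variables (m : nat) (M : manifoldType R m).
Implicit Types p x : M.

Lemma cdom_nbhs p x : cdom (chart_at p) x -> nbhs x (cdom (chart_at p)).
Proof. by move=> px; apply: open_nbhs_nbhs; split => //; exact: cdom_open. Qed.

Lemma cran_chart p x : cdom (chart_at p) x ->
  cran (chart_at p) (chart_at p x).
Proof. by move=> px; exists x. Qed.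

Lemma cinv_chart_continuous p x : cdom (chart_at p) x ->
  cinv (chart_at p) y @[y --> chart_at p x] --> x.
Proof.
move=> px; have := cinv_continuous (cran_chart px).
by rewrite /prop_for /continuous_at cmapK.
Qed.

Lemma cinv_chart_near p x (A : set M) : cdom (chart_at p) x -> nbhs x A ->
  \forall y \near chart_at p x, A (cinv (chart_at p) y).
Proof. by move=> px; apply: (cinv_chart_continuous px). Qed.

Lemma cran_near p x : cdom (chart_at p) x ->
  \forall y \near chart_at p x, cran (chart_at p) y.
Proof.
move=> px; apply: open_nbhs_nbhs; split; first exact: cran_open.
exact: cran_chart.
Qed.

Lemma chart_cinv_near p x : cdom (chart_at p) x ->
  \forall y \near chart_at p x, chart_at p (cinv (chart_at p) y) = y.
Proof. by move=> /cran_near; apply: filterS => y [z pz <-]; rewrite cmapK. Qed.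

Lemma tloc_id p x v : cdom (chart_at p) x -> tloc p p (@id M) x v = v.
Proof.
move=> px; rewrite /tloc (near_eq_diff (f := id)); last first.
- exact: ex_diff.
- by move: (chart_cinv_near px); apply: filterS.
by rewrite (@diff_val _ _ _ _ _ _ _ (is_diff_id _)).
Qed.

End OneManifold.

Section TwoManifolds.
Variables (m n : nat) (M : manifoldType R m) (N : manifoldType R n).

Lemma smooth_map_mdiff (f : M -> N) x : smooth_map f -> mdiff_at f x.
Proof.
move=> [fc fs]; split=> [|p q px qfx]; first exact: fc.
have [/(_ (chart_at p x)) d _] := fs p q 1%N.
by apply: d; split; [exact: cran_chart|rewrite cmapK].
Qed.

Lemma tlocD (p : M) (q : N) f x u v :
  tloc p q f x (u + v) = tloc p q f x u + tloc p q f x v.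
Proof. by rewrite /tloc linearD. Qed.

Lemma tlocZ (p : M) (q : N) f x (a : R) v :
  tloc p q f x (a *: v) = a *: tloc p q f x v.
Proof. by rewrite /tloc linearZ. Qed.

Lemma is_derive_chart_comp (c : R -> M) (f : M -> N) (s : R) p q v :
  {for s, continuous c} -> mdiff_at f (c s) -> cdom (chart_at p) (c s) ->
  cdom (chart_at q) (f (c s)) -> is_derive s 1 (chart_at p \o c) v ->
  is_derive s 1 (chart_at q \o (f \o c)) (tloc p q f (c s) v).
Proof.
move=> cc [fc fd] ps qs dc.
apply: near_eq_is_derive (is_derive1_comp dc (fd p q ps qs)).
have : \forall u \near s, cdom (chart_at p) (c u) by exact: cc (cdom_nbhs ps).
by apply: filterS => u pu; rewrite /= /loc cmapK.
Qed.

End TwoManifolds.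

(** The intermediate chart [q] cancels only where [f] takes values in its domain, which continuity
    ensures near [x]. *)
Lemma loc_comp_near (m n k : nat) (M : manifoldType R m)
    (N : manifoldType R n) (P : manifoldType R k) (f : M -> N) (g : N -> P)
    x p q r :
  {for x, continuous f} -> cdom (chart_at p) x -> cdom (chart_at q) (f x) ->
  {near chart_at p x, loc q r g \o loc p q f =1 loc p r (g \o f)}.
Proof.
move=> fc px qfx.
have : \forall y \near x, cdom (chart_at q) (f y) by exact: fc (cdom_nbhs qfx).
move/(cinv_chart_near px); apply: filterS => y qfy.
by rewrite /= /loc /= cmapK.
Qed.

Lemma mdiff_at_comp (m n k : nat) (M : manifoldType R m)
    (N : manifoldType R n) (P : manifoldType R k) (f : M -> N) (g : N -> P) x :
  mdiff_at f x -> mdiff_at g (f x) -> mdiff_at (g \o f) x.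
Proof.
move=> [fc fd] [gc gd]; split=> [|p r px rgfx]; first exact: continuous_comp.
have qfx := mem_chart_at (f x).
apply: near_eq_differentiable (loc_comp_near g r fc px qfx) _.
apply: differentiable_comp; first exact: fd.
by rewrite /loc cmapK//; exact: gd.
Qed.

Lemma tloc_comp (m n k : nat) (M : manifoldType R m)
    (N : manifoldType R n) (P : manifoldType R k) (f : M -> N) (g : N -> P)
    x p q r v :
  mdiff_at f x -> mdiff_at g (f x) -> cdom (chart_at p) x ->
  cdom (chart_at q) (f x) -> cdom (chart_at r) (g (f x)) ->
  tloc p r (g \o f) x v = tloc q r g (f x) (tloc p q f x v).
Proof.
move=> [fc fd] [gc gd] px qfx rgfx.
have df := fd _ _ px qfx; have dg := gd _ _ qfx rgfx.
have E : loc p q f (chart_at p x) = chart_at q (f x) by rewrite /loc cmapK.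
rewrite -E in dg.
rewrite /tloc (near_eq_diff (loc_comp_near g r fc px qfx)); last first.
  exact: differentiable_comp.
rewrite (diff_comp df dg) [LHS]/=.
by rewrite E.
Qed.

Section BinaryMaps.
Variables (m n k : nat) (M : manifoldType R m) (N : manifoldType R n)
  (P : manifoldType R k) (f : M -> N -> P).
Hypothesis f_smooth : smooth_map2 f.

Definition loc2 (p : M) (q : N) (r : P) (z : 'rV[R]_m * 'rV[R]_n) : 'rV[R]_k :=
  chart_at r (f (cinv (chart_at p) z.1) (cinv (chart_at q) z.2)).

Variables (p : M) (q : N) (r : P).

Let loc2_Ck j := f_smooth.2 p q r j.

Let dom x y : cdom (chart_at p) x -> cdom (chart_at q) y ->
  cdom (chart_at r) (f x y) ->
  [set z : 'rV[R]_m * 'rV[R]_n |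
     [/\ cran (chart_at p) z.1, cran (chart_at q) z.2 &
         cdom (chart_at r) (f (cinv (chart_at p) z.1) (cinv (chart_at q) z.2))]]
    (chart_at p x, chart_at q y).
Proof.
by move=> px qy rf; split => /=; [exact: cran_chart..|rewrite !cmapK].
Qed.

Lemma loc2_differentiable x y : cdom (chart_at p) x -> cdom (chart_at q) y ->
  cdom (chart_at r) (f x y) ->
  differentiable (loc2 p q r) (chart_at p x, chart_at q y).
Proof. by move=> px qy rf; apply: (loc2_Ck 1).1; exact: dom. Qed.

(** Applied to the multiplication of [G], this makes [Ad] and right-invariant vector fields
    differentiable, both being first derivatives of it. *)
Lemma loc2_derive_differentiable x y v :
  cdom (chart_at p) x -> cdom (chart_at q) y -> cdom (chart_at r) (f x y) ->
  differentiable ('D_v (loc2 p q r)) (chart_at p x, chart_at q y).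
Proof. by move=> px qy rf; apply: ((loc2_Ck 2).2 v).1; exact: dom. Qed.

Lemma loc2_derive2_continuous x y v w :
  cdom (chart_at p) x -> cdom (chart_at q) y -> cdom (chart_at r) (f x y) ->
  {for (chart_at p x, chart_at q y),
    continuous ('D_w ('D_v (loc2 p q r)))}.
Proof. by move=> px qy rf; apply: ((loc2_Ck 2).2 v).2; exact: dom. Qed.

Lemma is_derive_loc2 (c : R -> M) (e : R -> N) (s : R) v w :
  {for s, continuous c} -> {for s, continuous e} ->
  cdom (chart_at p) (c s) -> cdom (chart_at q) (e s) ->
  cdom (chart_at r) (f (c s) (e s)) ->
  is_derive s 1 (chart_at p \o c) v -> is_derive s 1 (chart_at q \o e) w ->
  is_derive s 1 (fun u => chart_at r (f (c u) (e u)))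
    ('d (loc2 p q r) (chart_at p (c s), chart_at q (e s)) (v, w)).
Proof.
move=> cc ce ps qs rs dc de.
have dce : is_derive s 1 (fun u => (chart_at p (c u), chart_at q (e u))) (v, w).
  have [[dc' <-] [de' <-]] := (dc, de).
  move/derivable1_diffP : dc' => dc'; move/derivable1_diffP : de' => de'.
  have d2 := differentiable_pair dc' de'.
  split; first exact/derivable1_diffP.
  by rewrite !deriveE// diff_pair.
apply: near_eq_is_derive (is_derive1_comp dce (loc2_differentiable ps qs rs)).
have pn : \forall u \near s, cdom (chart_at p) (c u) by exact: cc (cdom_nbhs ps).
have qn : \forall u \near s, cdom (chart_at q) (e u) by exact: ce (cdom_nbhs qs).
by apply: filterS2 pn qn => u pu qu; rewrite /= /loc2 /= !cmapK.
Qed.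

End BinaryMaps.

Section PartialMaps.
Variables (m n k : nat) (M : manifoldType R m) (N : manifoldType R n)
  (P : manifoldType R k) (f : M -> N -> P).
Hypothesis f_smooth : smooth_map2 f.

(** Fixing the first argument amounts to composing with the affine embedding of the second factor,
    whose differential is [v |-> (0, v)]. *)
Let locl x y p q r : cdom (chart_at p) x -> cdom (chart_at q) y ->
  cdom (chart_at r) (f x y) -> is_diff (chart_at q y) (loc q r (f x))
    (fun v => 'D_(0, v) (loc2 f p q r) (chart_at p x, chart_at q y)).
Proof.
move=> px qy rf; have dl := loc2_differentiable f_smooth px qy rf.
have -> : loc q r (f x) = loc2 f p q r \o (fun y => (chart_at p x, y)).
  by apply/funext => z; rewrite /loc /loc2 /= cmapK.
have dp := is_diff_pair_cstl (chart_at p x) (chart_at q y).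
have dpd : differentiable _ _ := @ex_diff _ _ _ _ _ _ _ dp.
split; first exact: differentiable_comp dpd dl.
rewrite (diff_comp dpd dl).
by apply/funext => v; rewrite /= (@diff_val _ _ _ _ _ _ _ dp) deriveE.
Qed.

Let locr x y p q r : cdom (chart_at p) x -> cdom (chart_at q) y ->
  cdom (chart_at r) (f x y) -> is_diff (chart_at p x) (loc p r (f ^~ y))
    (fun v => 'D_(v, 0) (loc2 f p q r) (chart_at p x, chart_at q y)).
Proof.
move=> px qy rf; have dl := loc2_differentiable f_smooth px qy rf.
have -> : loc p r (f ^~ y) = loc2 f p q r \o (fun x => (x, chart_at q y)).
  by apply/funext => z; rewrite /loc /loc2 /= cmapK.
have dp := is_diff_pair_cstr (chart_at q y) (chart_at p x).
have dpd : differentiable _ _ := @ex_diff _ _ _ _ _ _ _ dp.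
split; first exact: differentiable_comp dpd dl.
rewrite (diff_comp dpd dl).
by apply/funext => v; rewrite /= (@diff_val _ _ _ _ _ _ _ dp) deriveE.
Qed.

Lemma mdiff_at_partiall x y : mdiff_at (f x) y.
Proof.
split=> [|q r qy rf]; last by case: (locl (mem_chart_at x) qy rf).
apply: (@continuous_comp _ _ _ (fun y => (x, y)) (fun z => f z.1 z.2)).
  by apply: cvg_pair; [exact: cvg_cst|exact: cvg_id].
exact: f_smooth.1.
Qed.

Lemma mdiff_at_partialr x y : mdiff_at (f ^~ y) x.
Proof.
split=> [|p r px rf]; last by case: (locr px (mem_chart_at y) rf).
apply: (@continuous_comp _ _ _ (fun x => (x, y)) (fun z => f z.1 z.2)).
  by apply: cvg_pair; [exact: cvg_id|exact: cvg_cst].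
exact: f_smooth.1.
Qed.

Lemma tloc_partiall x y p q r v : cdom (chart_at p) x ->
  cdom (chart_at q) y -> cdom (chart_at r) (f x y) ->
  tloc q r (f x) y v =
    'D_(0, v) (loc2 f p q r) (chart_at p x, chart_at q y).
Proof. by move=> px qy rf; rewrite /tloc; have [_ ->] := locl px qy rf. Qed.

Lemma tloc_partialr x y p q r v : cdom (chart_at p) x ->
  cdom (chart_at q) y -> cdom (chart_at r) (f x y) ->
  tloc p r (f ^~ y) x v =
    'D_(v, 0) (loc2 f p q r) (chart_at p x, chart_at q y).
Proof. by move=> px qy rf; rewrite /tloc; have [_ ->] := locr px qy rf. Qed.

End PartialMaps.
End ManifoldMaps.

(** Since the curve may leave any given chart, the mean value inequality only yields local
    constancy; it is then made global on the interval. *)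
Lemma stationary_curve_constant (R : realType) (m : nat)
    (M : manifoldType R m) (h : R -> M) (a b : R) :
  (forall s, a < s < b -> {for s, continuous h} /\
    forall p, cdom (chart_at p) (h s) -> is_derive s 1 (chart_at p \o h) 0) ->
  forall s u, a < s < b -> a < u < b -> h u = h s.
Proof.
move=> h0.
have loc_cst s : a < s < b -> \forall u \near s, h u = h s.
  move=> sab; have [hc _] := h0 s sab.
  have hs := mem_chart_at (h s).
  have : \forall u \near s, (a < u < b) /\ cdom (chart_at (h s)) (h u).
    apply: filterI; last exact: hc (cdom_nbhs hs).
    have : s \in `]a, b[%R by rewrite in_itv.
    by move=> /near_in_itvoo; apply: filterS => u; rewrite /= in_itv.
  move=> /nbhs_ballP[r /= r0 br].
  (* Halving the radius puts the closed interval required by [mx_norm_MVT] inside the open ball. *)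
  apply/nbhs_ballP; exists (r / 2) => /=; first by rewrite divr_gt0.
  move=> u; rewrite /ball /= => us.
  have br' v : s - r / 2 <= v <= s + r / 2 ->
      (a < v < b) /\ cdom (chart_at (h s)) (h v).
    move=> /andP[v1 v2]; apply: br; rewrite /ball /= ltr_norml.
    by apply/andP; split; lra.
  have smem : s - r / 2 <= s <= s + r / 2 by apply/andP; split; lra.
  have umem : s - r / 2 <= u <= s + r / 2.
    by move: us; rewrite ltr_norml => /andP[u1 u2]; apply/andP; split; lra.
  have := @mx_norm_MVT R 1 m (chart_at (h s) \o h) (cst 0) (s - r / 2)
    (s + r / 2) 0 (lexx 0) _ _ s u smem umem.
  rewrite mul0r normr_le0 subr_eq0 /= => H.
  have E : chart_at (h s) (h u) = chart_at (h s) (h s).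
    apply/eqP; apply: H => v /br'[vab vh]; last by rewrite normr0.
    exact: (h0 v vab).2.
  by rewrite -(cmapK (br' _ umem).2) E cmapK.
(* The indicator function of [h v = h s] is locally constant as well. *)
move=> s u sab uab.
pose f v : R := `[< h v = h s >]%:R.
have df v : a < v < b -> is_derive v 1 f 0.
  move=> /loc_cst hv; apply: near_eq_is_derive (is_derive_cst (f v) v 1).
  by move: hv; apply: filterS => x hx; rewrite /f hx.
have := is_derive0_itvoo_constant df sab uab.
rewrite /f (asboolT (erefl (h s))) => /eqP.
by case: asboolP => // _; rewrite oner_eq0.
Qed.

(** * The adjoint action *)

Section AdjointAction.
Context {R : realType} {n : nat} {G : lieGroupType R n}.
Implicit Types (g h p q : G) (eta : 'rV[R]_n).

Local Notation e := (1%g : G).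
Local Notation phi := (chart_at e).

Let mem1 : cdom phi e := mem_chart_at e.

Lemma mdiff_mulg g h : mdiff_at (fun h : G => (g * h)%g) h.
Proof. exact: (mdiff_at_partiall (@lie_mul_smooth R n G)). Qed.

Lemma mdiff_mulgr g h : mdiff_at (fun h : G => (h * g)%g) h.
Proof. exact: (mdiff_at_partialr (@lie_mul_smooth R n G)). Qed.

Lemma mdiff_invg h : mdiff_at (fun h : G => (h^-1)%g) h.
Proof. exact: smooth_map_mdiff (@lie_inv_smooth R n G). Qed.

Lemma mdiff_conj g h : mdiff_at (fun h : G => (g * (h * g^-1))%g) h.
Proof.
exact: (mdiff_at_comp (mdiff_mulgr g^-1%g h) (mdiff_mulg g (h * g^-1)%g)).
Qed.

(** The chain rule absorbs the chart at [g^-1]: [Ad g] becomes the differential at [1] of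
    conjugation, read in one chart. Linearity and multiplicativity follow from this form. *)
Lemma Ad_conj g eta :
  Ad g eta = tloc e e (fun h => (g * (h * g^-1))%g) e eta.
Proof.
have m1 := mem_chart_at (g^-1)%g.
rewrite /Ad /tmap mul1g mulgV.
have := @tloc_comp R _ _ _ G G G (fun h => (h * g^-1)%g) (fun h => (g * h)%g)
  e e (g^-1)%g e eta (mdiff_mulgr _ _) (mdiff_mulg _ _) mem1.
by rewrite /= mul1g mulgV => ->.
Qed.

(** The definition of [Ad] passes through the chart at [g^-1], which changes with [g]. With a free
    [q], one fixed chart serves for all [g] near [1]. *)
Lemma Ad_via g eta q : cdom (chart_at q) (g^-1)%g ->
  Ad g eta = tloc q e (fun h => (g * h)%g) (g^-1)%g
    (tloc e q (fun h => (h * g^-1)%g) e eta).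
Proof.
move=> qg; rewrite Ad_conj.
have := @tloc_comp R _ _ _ G G G (fun h => (h * g^-1)%g) (fun h => (g * h)%g)
  e e q e eta (mdiff_mulgr _ _) (mdiff_mulg _ _) mem1.
by rewrite /= mul1g mulgV => ->.
Qed.

Lemma AdD g u v : Ad g (u + v) = Ad g u + Ad g v.
Proof. by rewrite !Ad_conj tlocD. Qed.

Lemma AdZ g (c : R) v : Ad g (c *: v) = c *: Ad g v.
Proof. by rewrite !Ad_conj tlocZ. Qed.

Lemma Ad1 eta : Ad e eta = eta.
Proof.
rewrite Ad_conj (_ : (fun _ => _) = id) ?tloc_id//.
by apply/funext => h; rewrite mul1g invg1 mulg1.
Qed.

Lemma AdM g h eta : Ad (g * h)%g eta = Ad g (Ad h eta).
Proof.
rewrite !Ad_conj (_ : (fun _ => _) = (fun k => (g * (k * g^-1))%g) \o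
    (fun k => (h * (k * h^-1))%g)); last first.
  by apply/funext => k /=; rewrite invgM !mulgA.
have he : (h * (1 * h^-1))%g = e by rewrite mul1g mulgV.
have ge : (g * (1 * g^-1))%g = e by rewrite mul1g mulgV.
have := @tloc_comp R _ _ _ G G G (fun k => (h * (k * h^-1))%g)
  (fun k => (g * (k * g^-1))%g) e e e e eta (mdiff_conj _ _) (mdiff_conj _ _).
by rewrite he ge; exact.
Qed.

Lemma AdK g eta : Ad g (Ad (g^-1)%g eta) = eta.
Proof. by rewrite -AdM mulgV Ad1. Qed.

(** In the formula for [Ad], the outer derivative is taken in a direction [w y] that varies with
    [y], whereas smoothness speaks of fixed directions. Expanding [w y] in the canonical basis
    separates the two dependences. *)
Lemma Ad_chart_differentiable eta :
  differentiable (fun y => Ad (cinv phi y) eta) (phi e).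
Proof.
pose m := loc2 (fun g h : G => (g * h)%g) e e e.
pose i : 'rV[R]_n -> 'rV[R]_n := loc e e (fun h : G => (h^-1)%g).
pose w y := 'D_(eta, 0) m (phi e, i y).
have ms := @lie_mul_smooth R n G.
have inve : cdom phi (e^-1)%g by rewrite invg1.
have ie : i (phi e) = phi e by rewrite /i /loc cmapK// invg1.
have di : differentiable i (phi e) by exact: (mdiff_invg e).2.
(* The chain rule for h |-> g (h g^-1), where y = phi g and i y = phi g^-1. *)
pose F y := \sum_(j < n) w y 0 j *: 'D_(0, delta_mx 0 j) m (y, i y).
have FE : {near phi e, F =1 (fun y => Ad (cinv phi y) eta)}.
  have n1 := cran_near mem1.
  have n2 : \forall y \near phi e, cdom phi (cinv phi y)^-1%g.
    apply: (cinv_chart_near (A := fun h => cdom phi h^-1%g) mem1).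
    by apply: (mdiff_invg e).1; rewrite invg1; exact: cdom_nbhs.
  apply: filterS2 n1 n2 => _ [g eg <-]; rewrite cmapK// => eg'.
  have iE : i (phi g) = phi (g^-1)%g by rewrite /i /loc cmapK.
  have egg : cdom phi (g * g^-1)%g by rewrite mulgV.
  have eg1 : cdom phi (1 * g^-1)%g by rewrite mul1g.
  rewrite (Ad_via _ eg') (tloc_partiall ms _ eg eg' egg).
  rewrite (tloc_partialr ms _ mem1 eg' eg1) -/m -iE -/(w (phi g)).
  have dm : differentiable m (phi g, i (phi g)).
    by rewrite iE; exact: loc2_differentiable.
  rewrite /F deriveE// (_ : (0, w _) =
      \sum_(j < n) w (phi g) 0 j *: ((0, delta_mx 0 j) : 'rV[R]_n * 'rV[R]_n)).
    rewrite linear_sum; apply: eq_bigr => j _.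
    by rewrite linearZ /= deriveE.
  apply/esym/eqP; rewrite -pair_eqE /=; apply/andP; split; apply/eqP.
    rewrite (big_morph fst (id1 := 0) (op1 := +%R))//.
    by rewrite big1// => j _; rewrite /= scaler0.
  rewrite (big_morph snd (id1 := 0) (op1 := +%R))//=.
  by rewrite -row_sum_delta.
apply: near_eq_differentiable FE _.
have e11 : cdom phi (e * e)%g by rewrite mulg1.
rewrite (_ : F = \sum_(j < n)
    (fun y => w y 0 j *: 'D_(0, delta_mx 0 j) m (y, i y))); last first.
  by apply/funext => y; rewrite /F fct_sumE.
apply: differentiable_sum => j; apply: differentiable_scale.
  have dw : differentiable w (phi e).
    have dp : differentiable (fun y => (phi e, i y)) (phi e).
      exact: differentiable_pair (differentiable_cst _ _) di.
    have dm : differentiable ('D_(eta, 0) m) (phi e, i (phi e)).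
      by rewrite ie; exact: (loc2_derive_differentiable ms).
    exact: (differentiable_comp dp dm).
  exact: (differentiable_comp dw (differentiable_coord _ 0 j)).
have dp : differentiable (fun y => (y, i y)) (phi e).
  by apply: differentiable_pair di; exact: ex_diff.
have dm : differentiable ('D_(0, delta_mx 0 j) m) (phi e, i (phi e)).
  by rewrite ie; exact: (loc2_derive_differentiable ms).
exact: (differentiable_comp dp dm).
Qed.

(** The bracket of the Lie algebra, defined without the exponential map so as to be available before
    one-parameter subgroups; [ad_dAd] identifies it with [ad]. *)
Definition dAd (xi eta : 'rV[R]_n) : 'rV[R]_n :=
  'd (fun y => Ad (cinv phi y) eta) (phi e) xi.

Lemma is_derive_Ad1 (b : R -> G) (s : R) xi eta :
  {for s, continuous b} -> b s = e -> is_derive s 1 (phi \o b) xi ->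
  is_derive s 1 (fun u => Ad (b u) eta) (dAd xi eta).
Proof.
move=> bc bs db.
have bE : (phi \o b) s = phi e by rewrite /= bs.
have dA : differentiable (fun y => Ad (cinv phi y) eta) ((phi \o b) s).
  by rewrite bE; exact: Ad_chart_differentiable.
have := is_derive1_comp db dA; rewrite bE; apply: near_eq_is_derive.
have : \forall u \near s, cdom phi (b u).
  by apply: bc; rewrite bs; exact: cdom_nbhs.
by apply: filterS => u ub; rewrite /= cmapK.
Qed.

(** Near [g], [Ad h eta] is [Ad (h * g^-1) (Ad g eta)], and [h * g^-1] tends to [1]. *)
Lemma Ad_continuous g eta : {for g, continuous (fun h => Ad h eta)}.
Proof.
have c1 : (h * g^-1)%g @[h --> g] --> e.
  by have := (mdiff_mulgr g^-1%g g).1; rewrite /prop_for /continuous_at mulgV.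
have c2 : phi (h * g^-1)%g @[h --> g] --> phi e.
  exact: (continuous_cvg _ (cmap_continuous mem1) c1).
have c3 := differentiable_continuous (Ad_chart_differentiable (Ad g eta)).
have c4 : Ad (cinv phi (phi (h * g^-1)%g)) (Ad g eta) @[h --> g] -->
    Ad (cinv phi (phi e)) (Ad g eta).
  exact: cvg_comp c2 c3.
rewrite /prop_for /continuous_at.
rewrite (cmapK mem1) Ad1 in c4.
have E : \forall h \near g, Ad (cinv phi (phi (h * g^-1)%g)) (Ad g eta) = Ad h eta.
  have : \forall h \near g, cdom phi (h * g^-1)%g by exact: c1 (cdom_nbhs mem1).
  by apply: filterS => h hg; rewrite /= cmapK// -AdM mulgVK.
exact: cvg_trans (near_eq_cvg E) c4.
Qed.

(* [c] has at time [s] the velocity [xi], pulled back to the Lie algebra by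
   right translation. *)
Definition rvelocity (c : R -> G) (s : R) (xi : 'rV[R]_n) : Prop :=
  {for s, continuous c} /\
  is_derive s 1 (fun u => phi (c u * (c s)^-1)%g) xi.

Lemma is_derive_Ad (c : R -> G) (s : R) xi eta : rvelocity c s xi ->
  is_derive s 1 (fun u => Ad (c u) eta) (dAd xi (Ad (c s) eta)).
Proof.
move=> [cc dc].
rewrite (_ : (fun u => _) = fun u => Ad (c u * (c s)^-1)%g (Ad (c s) eta)).
  have bc : {for s, continuous (fun u => (c u * (c s)^-1)%g)}.
    exact: continuous_comp cc (mdiff_mulgr _ _).1.
  exact: (is_derive_Ad1 _ bc (mulgV (c s)) dc).
by apply/funext => u; rewrite -AdM mulgVK.
Qed.

Lemma rvelocity_chart (c : R -> G) (s : R) p v :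
  {for s, continuous c} -> cdom (chart_at p) (c s) ->
  is_derive s 1 (chart_at p \o c) v ->
  rvelocity c s (tloc p e (fun h => (h * (c s)^-1)%g) (c s) v).
Proof.
move=> cc ps dc; split => //.
apply: (is_derive_chart_comp cc (mdiff_mulgr (c s)^-1%g (c s)) ps _ dc).
by rewrite mulgV.
Qed.

(** Up to left translation by [(c s)^-1] and right translation by [d s], the curve [c^-1 d] is the
    product of two curves through [1], whose velocities at [s] are determined by [xi] alone. *)
Lemma invg_mulg_stationary (c d : R -> G) (s : R) xi p :
  rvelocity c s xi -> rvelocity d s xi ->
  cdom (chart_at p) ((c s)^-1 * d s)%g ->
  is_derive s 1 (fun u => chart_at p ((c u)^-1 * d u)%g) 0.
Proof.
move=> rc rd ph.
pose shifted (c : R -> G) u := (c u * (c s)^-1)%g.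
have sc b : rvelocity b s xi -> {for s, continuous (shifted b)}.
  by move=> [bc _]; exact: continuous_comp bc (mdiff_mulgr _ _).1.
pose xi' := tloc e e (fun h : G => (h^-1)%g) e xi.
have se b : shifted b s = e by rewrite /shifted mulgV.
have sie b : (shifted b s)^-1%g = e by rewrite se invg1.
have key a b : rvelocity a s xi -> rvelocity b s xi ->
    is_derive s 1 (fun u => phi ((shifted a u)^-1 * shifted b u)%g)
      ('d (loc2 (fun g h : G => (g * h)%g) e e e) (phi e, phi e) (xi', xi)).
  move=> ra rb.
  have sia : {for s, continuous (fun u => (shifted a u)^-1%g)}.
    exact: continuous_comp (sc _ ra) (mdiff_invg _).1.
  have da : is_derive s 1 (phi \o (fun u => (shifted a u)^-1%g)) xi'.
    have := @is_derive_chart_comp R _ _ G G (shifted a) (fun h => (h^-1)%g) s e e xi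
      (sc _ ra) (mdiff_invg _).
    by rewrite se /= invg1; apply => //; case: ra.
  have := @is_derive_loc2 R _ _ _ G G G _ (@lie_mul_smooth R n G) e e e
    _ _ s xi' xi sia (sc _ rb).
  by rewrite sie se mulg1; apply => //; case: rb.
(* The derivative found in [key] depends on [xi] only, so that it is the one
   of the constant curve c^-1 c. *)
have K0 : 'd (loc2 (fun g h : G => (g * h)%g) e e e) (phi e, phi e) (xi', xi) = 0.
  apply: is_derive1_unique (key _ _ rc rc) _.
  rewrite (_ : (fun u => _) = cst (phi e)); first exact: is_derive_cst.
  by apply/funext => u; rewrite mulVg.
have := key _ _ rc rd; rewrite K0.
set z := (fun u => ((shifted c u)^-1 * shifted d u)%g) => dz.
have zc : {for s, continuous z}.
  apply: (@continuous_comp _ _ _ (fun u => ((shifted c u)^-1, shifted d u)%g)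
    (fun z => (z.1 * z.2)%g)).
    apply: cvg_pair; last exact: sc rd.
    exact: continuous_comp (sc _ rc) (mdiff_invg _).1.
  exact: (@lie_mul_smooth R n G).1.
pose f h := ((c s)^-1 * (h * d s))%g.
have fd : mdiff_at f (z s).
  exact: (mdiff_at_comp (mdiff_mulgr (d s) (z s)) (mdiff_mulg _ _)).
have zs : z s = e by rewrite /z /= sie se mulg1.
have := is_derive_chart_comp zc fd (p := e) (q := p) (v := 0).
rewrite zs /f mul1g => /(_ mem1 ph dz).
rewrite /tloc linear0 => dh.
rewrite (_ : (fun u => _) = chart_at p \o (f \o z))//.
apply/funext => u; congr (chart_at p _).
by rewrite /f /z /shifted /= invgM invgK !mulgA mulVg mul1g mulgVK.
Qed.

End AdjointAction.

(** * One-parameter subgroups *)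

Section Exponential.
Context {R : realType} {n : nat} {G : lieGroupType R n}.
Implicit Types (xi eta : 'rV[R]_n) (c : R -> G).

Local Notation e := (1%g : G).
Local Notation phi := (chart_at e).

Let mem1 : cdom phi e := mem_chart_at e.

Lemma one_parameter_subgroup0 xi c : one_parameter_subgroup xi c -> c 0 = e.
Proof.
move=> [cD _ _]; apply: (@mulgI G (c 0)).
by rewrite -cD addr0 mulg1.
Qed.

Lemma one_parameter_subgroup_derive0 xi c : one_parameter_subgroup xi c ->
  is_derive (0 : R) 1 (phi \o c) xi.
Proof.
move=> cP; have c0 := one_parameter_subgroup0 cP.
case: cP => _ /(_ 0)[_]; rewrite /velocity derive1E c0 => dc E.
by split; [exact: dc|exact: E].
Qed.

Lemma one_parameter_subgroup_rvelocity xi c (t : R) :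
  one_parameter_subgroup xi c -> rvelocity c t xi.
Proof.
move=> cP; have d0 := one_parameter_subgroup_derive0 cP.
case: cP => cD cc _; split; first by have [] := cc t.
rewrite (_ : (fun u => _) = fun u => (phi \o c) (u + - t)).
  by apply: is_derive1_addr; rewrite subrr.
by apply/funext => u; rewrite /= -{1}(subrK t u) cD mulgK.
Qed.

Lemma one_parameter_subgroup_unique xi c d :
  one_parameter_subgroup xi c -> one_parameter_subgroup xi d -> c = d.
Proof.
move=> cP dP; apply/funext => t.
have stat : forall s, - (`|t| + 1) < s < `|t| + 1 ->
    {for s, continuous (fun u => ((c u)^-1 * d u)%g)} /\
    forall p, cdom (chart_at p) ((c s)^-1 * d s)%g ->
      is_derive s 1 (chart_at p \o (fun u => ((c u)^-1 * d u)%g)) 0.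
  move=> s _.
  have rc := one_parameter_subgroup_rvelocity s cP.
  have rd := one_parameter_subgroup_rvelocity s dP.
  split=> [|p ps]; last exact: invg_mulg_stationary rc rd ps.
  apply: (@continuous_comp _ _ _ (fun u => ((c u)^-1, d u)%g)
    (fun z => (z.1 * z.2)%g)).
    apply: cvg_pair; last exact: rd.1.
    exact: continuous_comp rc.1 (mdiff_invg _).1.
  exact: (@lie_mul_smooth R n G).1.
have t1 : 0 < `|t| + 1 by rewrite ltr_wpDl.
have m0 : - (`|t| + 1) < 0 < `|t| + 1 by rewrite oppr_lt0 t1.
have mt : - (`|t| + 1) < t < `|t| + 1 by rewrite -ltr_norml ltrDl.
have := stationary_curve_constant stat m0 mt.
rewrite (one_parameter_subgroup0 cP) (one_parameter_subgroup0 dP) invg1 mulg1.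
by move=> E; rewrite -[d t](mulVKg (c t)) E mulg1.
Qed.

Lemma one_parameter_subgroup_scale xi c (eps : R) :
  one_parameter_subgroup xi c ->
  one_parameter_subgroup (eps *: xi) (fun t => c (eps * t)).
Proof.
move=> cP; have d0 := one_parameter_subgroup_derive0 cP.
have c0 := one_parameter_subgroup0 cP.
case: cP => cD cc _; split=> [s t|t|]; first by rewrite mulrDr cD.
  have [ct dt] := cc (eps * t); split.
    apply: (@continuous_comp _ _ _ (fun t => eps * t) c) ct.
    exact: mulrl_continuous.
  have := @is_derive1_scale R _ (chart_at (c (eps * t)) \o c) t eps
    ('D_1 (chart_at (c (eps * t)) \o c) (eps * t)).
  by move=> /(_ (derivableP dt)) [].
rewrite /velocity mulr0 c0 derive1E.
have := @is_derive1_scale R _ (phi \o c) 0 eps xi; rewrite mulr0.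
by move=> /(_ d0)[].
Qed.

(** Uniqueness forces the choice made by [xget] to be the rescaled [c], here evaluated at time 1. *)
Lemma lie_exp_one_parameter_subgroup xi c (eps : R) :
  one_parameter_subgroup xi c -> lie_exp (eps *: xi) = c eps.
Proof.
move=> /(one_parameter_subgroup_scale eps) cP.
rewrite /lie_exp (@xget_unique _ _ _ (fun t => c (eps * t))) ?mulr1//.
by move=> d dP; exact: one_parameter_subgroup_unique dP cP.
Qed.

Lemma ex_local_curve xi : exists2 delta : R, 0 < delta & exists c : R -> G,
  c 0 = e /\ forall t, `|t| < delta -> rvelocity c t xi.
Proof.
pose m := loc2 (fun g h : G => (g * h)%g) e e e.
have ms := @lie_mul_smooth R n G.
(* The right-invariant vector field of [xi] in the chart at [1]: at [phi g] it is the image of [xi]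
   under the differential of [h |-> h * g] at [1]. *)
pose X y := 'D_(xi, 0) m (phi e, y).
have m1 g : cdom phi g -> cdom phi (1 * g)%g by rewrite mul1g.
have dF g v : cdom phi g -> differentiable ('D_v m) (phi e, phi g).
  by move=> pg; apply: (loc2_derive_differentiable ms) => //; exact: m1.
have dX g : cdom phi g ->
    is_diff (phi g) X (fun v => 'D_(0, v) ('D_(xi, 0) m) (phi e, phi g)).
  move=> pg; have [dp dpE] := is_diff_pair_cstl (phi e) (phi g).
  have dX : differentiable X (phi g) := differentiable_comp dp (dF g _ pg).
  split => //; apply/funext => v; rewrite deriveE; last exact: dF.
  by rewrite /X (diff_comp dp (dF g _ pg)) /= dpE.
have X_diff : \forall y \near phi e, differentiable X y.
  by have := cran_near mem1; apply: filterS => _ [g pg <-]; case: (dX g pg).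
have X_C1 v : {for phi e, continuous ('D_v X)}.
  have DE : \forall y \near phi e,
      'D_(0, v) ('D_(xi, 0) m) (phi e, y) = 'D_v X y.
    have := cran_near mem1; apply: filterS => _ [g pg <-].
    by have [dXg dXE] := dX g pg; rewrite [in RHS]deriveE// dXE.
  have cD : {for phi e, continuous (fun y => 'D_(0, v) ('D_(xi, 0) m) (phi e, y))}.
    apply: (@continuous_comp _ _ _ (fun y => (phi e, y))
      ('D_(0, v) ('D_(xi, 0) m))).
      apply: differentiable_continuous.
      by case: (is_diff_pair_cstl (phi e) (phi e)).
    by apply: (loc2_derive2_continuous ms) => //; exact: m1.
  rewrite /prop_for /continuous_at -(nbhs_singleton DE).
  exact: cvg_trans (near_eq_cvg DE) cD.
have [y [y0 yP]] := C1_local_solution X_diff X_C1.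
have : \forall t \near 0, is_derive (t : R) 1 y (X (y t)) /\ cran phi (y t).
  apply: filterI => //.
  have yc := is_derive_continuous (nbhs_singleton yP).
  have cy : nbhs (y 0) (cran phi) by rewrite y0; exact: cran_near.
  exact: (yc _ cy).
move=> /nbhs_ballP[delta /= d0 ballP]; exists delta => //.
exists (cinv phi \o y); split; first by rewrite /= y0 cmapK.
move=> t td.
have inP (s : R) : `|s| < delta -> is_derive s 1 y (X (y s)) /\ cran phi (y s).
  by move=> sd; apply: ballP; rewrite -ball_normE /= sub0r normrN.
have [dy [g pg yg]] := inP t td.
have ct : {for t, continuous (cinv phi \o y)}.
  apply: continuous_comp; first exact: is_derive_continuous dy.
  by apply: cinv_continuous; rewrite -yg; exists g.
have cE : (cinv phi \o y) t = g by rewrite /= -yg cmapK.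
have dphi : is_derive t 1 (phi \o (cinv phi \o y)) (X (y t)).
  apply: near_eq_is_derive dy; apply/nbhs_ballP.
  exists (delta - `|t|) => [|s] /=; first by rewrite subr_gt0.
  rewrite -ball_normE /= => ts.
  have [|_ [h ph <-]] := inP s; last by rewrite cmapK.
  have : `|s| <= `|t| + `|t - s| by rewrite -{1}(subKr t s) ler_normB.
  by move: ts; lra.
have pt : cdom phi ((cinv phi \o y) t) by rewrite cE.
(* Right translation by [g^-1] undoes the one by [g] that defines [X] at [phi g]. *)
have -> : xi = tloc e e (fun h => (h * ((cinv phi \o y) t)^-1)%g)
    ((cinv phi \o y) t) (X (y t)); last exact: rvelocity_chart ct pt dphi.
rewrite cE -yg /X -(tloc_partialr ms _ mem1 pg (m1 g pg)).
have := @tloc_comp R _ _ _ G G G (fun h => (h * g)%g) (fun h => (h * g^-1)%g)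
  e e e e xi (mdiff_mulgr _ _) (mdiff_mulgr _ _) mem1.
rewrite mul1g mulgV => /(_ pg mem1) <-.
rewrite (_ : _ \o _ = id) ?tloc_id//.
by apply/funext => h /=; rewrite mulgK.
Qed.

(** The curves [c u] and [c (u + t)] have the same right-invariant velocity, so
    [(c u)^-1 * c (u + t)] is constant; at [u = 0] it is [c t]. *)
Lemma ex_local_subgroup xi : exists2 delta : R, 0 < delta & exists c : R -> G,
  [/\ c 0 = e,
      forall s t, `|s| < delta -> `|t| < delta -> `|s + t| < delta ->
        c (s + t) = (c s * c t)%g &
      forall t, `|t| < delta -> rvelocity c t xi].
Proof.
have [delta d0 [c [c0 cP]]] := ex_local_curve xi.
exists delta => //; exists c; split => // s t sd td std.
(* The interval between [a] and [b] consists of the times [v] at which [c v] and [c (v + t)] are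
   both controlled; it contains 0 and [s]. *)
pose a := Num.max (- delta) (- delta - t).
pose b := Num.min delta (delta - t).
have mem v : (a < v < b) = (`|v| < delta) && (`|v + t| < delta).
  by rewrite gt_max lt_min andbACA ltrBlDr ltrBrDr -!ltr_norml.
have stat : forall v : R, a < v < b ->
    {for v, continuous (fun u => ((c u)^-1 * c (u + t))%g)} /\
    forall p, cdom (chart_at p) ((c v)^-1 * c (v + t))%g ->
      is_derive v 1 (chart_at p \o (fun u => ((c u)^-1 * c (u + t))%g)) 0.
  move=> v; rewrite mem => /andP[vd vtd].
  have rc := cP v vd.
  have rd : rvelocity (fun u => c (u + t)) v xi.
    have [ccv dcv] := cP _ vtd; split; last first.
      exact: (is_derive1_addr (c := fun x => phi (c x * (c (v + t))^-1)%g) dcv).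
    apply: (@continuous_comp _ _ _ (fun u => u + t) c _ _ ccv).
    by apply: cvgD; [exact: cvg_id|exact: cvg_cst].
  split=> [|p ps]; last exact: invg_mulg_stationary rc rd ps.
  apply: (@continuous_comp _ _ _ (fun u => ((c u)^-1, c (u + t))%g)
    (fun z => (z.1 * z.2)%g)).
    apply: cvg_pair; last exact: rd.1.
    exact: continuous_comp rc.1 (mdiff_invg _).1.
  exact: (@lie_mul_smooth R n G).1.
have m0 : a < 0 < b by rewrite mem normr0 d0 add0r.
have ms : a < s < b by rewrite mem sd.
have := stationary_curve_constant stat m0 ms.
rewrite c0 invg1 mul1g add0r => <-.
by rewrite mulVKg.
Qed.

Lemma ex_one_parameter_subgroup xi : exists c : R -> G, one_parameter_subgroup xi c.
Proof.
have [delta d0 [c [c0 cD cv]]] := ex_local_subgroup xi.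
have small (r : R) N j : `|r| < delta -> (j <= N.+1)%N ->
    `|j%:R * (r / N.+1%:R)| < delta.
  move=> rd jN; apply: le_lt_trans rd.
  rewrite mulrCA normrM ler_piMr// ger0_norm ?divr_ge0//.
  by rewrite ler_pdivrMr ?ltr0n// mul1r ler_nat.
have cX (r : R) N : `|r| < delta -> c r = (c (r / N.+1%:R)%R ^+ N.+1)%g.
  move=> rd.
  have H j : (j <= N.+1)%N -> c (j%:R * (r / N.+1%:R)) = (c (r / N.+1%:R)%R ^+ j)%g.
    elim: j => [|j IH] jN; first by rewrite mul0r c0 expg0.
    have E : j.+1%:R * (r / N.+1%:R) = j%:R * (r / N.+1%:R) + r / N.+1%:R.
      by rewrite -[in LHS]natr1 mulrDl mul1r.
    rewrite E cD ?IH ?expgSr//; try exact: ltnW.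
    - by apply: small => //; exact: ltnW.
    - by have := @small r N 1 rd isT; rewrite mul1r.
    - by rewrite -E; exact: small.
  by rewrite -H// mulrCA divff ?mulr1// pnatr_eq0.
have div_small (t : R) N : `|t| < N.+1%:R * delta -> `|t / N.+1%:R| < delta.
  move=> tN; rewrite normrM normfV (@ger0_norm _ N.+1%:R)//.
  by rewrite ltr_pdivrMr ?ltr0n// mulrC.
(* Both powers equal the one obtained with the common step [t / (N.+1 * M.+1)]. *)
have cXX (t : R) N M : `|t| < N.+1%:R * delta -> `|t| < M.+1%:R * delta ->
    (c (t / N.+1%:R)%R ^+ N.+1 = c (t / M.+1%:R)%R ^+ M.+1)%g.
  move=> /div_small tN /div_small tM.
  rewrite (cX _ M tN) (cX _ N tM) -!expgnA mulnC.
  by rewrite -!mulrA [_^-1 * _^-1]mulrC.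
pose N (t : R) := Num.truncn (`|t| / delta).
have NP t : `|t| < (N t).+1%:R * delta.
  by rewrite -ltr_pdivrMr//; exact: truncnS_gt.
pose C t := (c (t / (N t).+1%:R)%R ^+ (N t).+1)%g.
have CE t M : `|t| < M.+1%:R * delta -> C t = (c (t / M.+1%:R)%R ^+ M.+1)%g.
  by move=> tM; exact: cXX.
have Cc t : `|t| < delta -> C t = c t.
  by move=> td; rewrite (CE t 0%N) ?mul1r// divr1 expg1.
have CD s t : C (s + t) = (C s * C t)%g.
  pose M := N (`|s| + `|t|).
  have le_M u : `|u| <= `|s| + `|t| -> `|u| < M.+1%:R * delta.
    move=> ul; apply: le_lt_trans ul _; rewrite /M.
    by have := NP (`|s| + `|t|); rewrite ger0_norm ?addr_ge0.
  have sM : `|s| < M.+1%:R * delta by apply: le_M; rewrite lerDl.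
  have tM : `|t| < M.+1%:R * delta by apply: le_M; rewrite lerDr.
  have stM : `|s + t| < M.+1%:R * delta by apply: le_M; exact: ler_normD.
  rewrite (CE _ M sM) (CE _ M tM) (CE _ M stM).
  have ds := div_small _ _ sM; have dt := div_small _ _ tM.
  have dst := div_small _ _ stM.
  rewrite mulrDl in dst.
  (* Both products are [c] of the same small sum; commutation then splits the power of the
     product. *)
  have cm : commute (c (s / M.+1%:R)%R) (c (t / M.+1%:R)%R).
    by rewrite /commute -cD// -cD//; [rewrite addrC|rewrite addrC].
  by rewrite mulrDl cD// expgMn.
have C0 : C 0 = e by rewrite Cc ?normr0.
(* Near any [t], [C] is a right translate of [c] near 0, from which it inherits continuity and
   derivability. *)
have nearC t : \forall u \near t, C u = (c (u - t) * C t)%g.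
  apply/nbhs_ballP; exists delta => //= u.
  rewrite -ball_normE /= distrC => ut.
  by rewrite -{1}(subrK t u) CD Cc.
have [cc dc] : rvelocity c 0 xi by apply: cv; rewrite normr0.
have {}dc : is_derive (0 : R) 1 (phi \o c) xi.
  by move: dc; rewrite c0 invg1; under eq_fun do rewrite mulg1.
have C_curve t : {for t, continuous C} /\ derivable (chart_at (C t) \o C) t 1.
  have ct : {for t, continuous (fun u => c (u - t))}.
    apply: (@continuous_comp _ _ _ (fun u => u - t) c).
      by apply: cvgB; [exact: cvg_id|exact: cvg_cst].
    by rewrite subrr.
  have Ct : (c (t - t) * C t)%g = C t by rewrite subrr c0 mul1g.
  split.
    rewrite /prop_for /continuous_at -Ct.
    have nC : \forall u \near t, (c (u - t) * C t)%g = C u.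
      by move: (nearC t); apply: filterS.
    apply: cvg_trans (near_eq_cvg nC) _.
    exact: (continuous_comp ct (mdiff_mulgr (C t) (c (t - t))).1).
  have dct : is_derive t 1 (phi \o (fun u => c (u - t))) xi.
    by apply: (is_derive1_addr (c := phi \o c)); rewrite subrr.
  have := is_derive_chart_comp (q := C t) ct
    (mdiff_mulgr (C t) (c (t - t))) (p := e) _ _ dct.
  rewrite subrr c0 mul1g => /(_ mem1 (mem_chart_at _)) H.
  have [//] : is_derive t 1 (chart_at (C t) \o C)
      (tloc e (C t) (fun h => (h * C t)%g) e xi).
  apply: near_eq_is_derive H.
  by move: (nearC t); apply: filterS => u /= ->.
exists C; split => //.
rewrite /velocity C0 derive1E.
have nC : \forall u \near (0 : R), phi (c u) = phi (C u).
  by move: (nearC 0); apply: filterS => u; rewrite subr0 C0 mulg1 => ->.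
by have [_ <-] := near_eq_is_derive nC dc.
Qed.

Lemma ad_dAd xi eta : ad (G := G) xi eta = dAd (G := G) xi eta.
Proof.
have [c cP] := ex_one_parameter_subgroup xi.
rewrite /ad derive1E.
under eq_fun do rewrite (lie_exp_one_parameter_subgroup _ cP).
have [cc _] := one_parameter_subgroup_rvelocity 0 cP.
have [_ <-//] := is_derive_Ad1 eta cc (one_parameter_subgroup0 cP)
  (one_parameter_subgroup_derive0 cP).
Qed.

End Exponential.

(** * The Euler-Lagrange system *)

Section Pairing.
Context {R : realType} {n : nat}.
Implicit Types (mu nu : 'cV[R]_n) (v w : 'rV[R]_n).

Lemma pairingE mu v : pairing mu v = \sum_(j < n) v 0 j * mu j 0.
Proof. by rewrite /pairing mxE. Qed.

Lemma pairingDl mu nu v : pairing (mu + nu) v = pairing mu v + pairing nu v.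
Proof. by rewrite /pairing mulmxDr mxE. Qed.

Lemma pairingNl mu v : pairing (- mu) v = - pairing mu v.
Proof. by rewrite /pairing mulmxN mxE. Qed.

Lemma pairingZl (a : R) mu v : pairing (a *: mu) v = a * pairing mu v.
Proof. by rewrite /pairing -scalemxAr mxE. Qed.

Lemma pairingDr mu v w : pairing mu (v + w) = pairing mu v + pairing mu w.
Proof. by rewrite /pairing mulmxDl mxE. Qed.

Lemma pairingZr mu (a : R) v : pairing mu (a *: v) = a * pairing mu v.
Proof. by rewrite /pairing -scalemxAl mxE. Qed.

Lemma pairing0l v : pairing 0 v = 0.
Proof. by rewrite /pairing mulmx0 mxE. Qed.

Lemma pairing_suml (I : Type) (r : seq I) (P : pred I) (F : I -> 'cV[R]_n) v :
  pairing (\sum_(i <- r | P i) F i) v = \sum_(i <- r | P i) pairing (F i) v.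
Proof. by rewrite /pairing mulmx_sumr summxE. Qed.

Lemma pairing_inj mu nu : (forall v, pairing mu v = pairing nu v) -> mu = nu.
Proof.
move=> E; apply/colP => j; have := E (delta_mx 0 j).
by rewrite /pairing -!rowE !mxE.
Qed.

(** Counterpart of [covectorP] for maps, such as those built from [Ad] and [ad], whose linearity is
    a proved fact rather than a structure. *)
Lemma pairing_covector (f : 'rV[R]_n -> R) v :
  (forall u w, f (u + w) = f u + f w) ->
  (forall (a : R) u, f (a *: u) = a * f u) -> pairing (covector f) v = f v.
Proof.
move=> fD fZ; rewrite pairingE {2}(row_sum_delta v) (big_morph f fD (id1 := 0)).
  by apply: eq_bigr => j _; rewrite mxE fZ.
by rewrite -(scale0r 0) fZ mul0r.
Qed.

Lemma is_derive_pairing (mu : R -> 'cV[R]_n) (v : R -> 'rV[R]_n) (s : R) dmu dv :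
  is_derive s 1 mu dmu -> is_derive s 1 v dv ->
  is_derive s 1 (fun x => pairing (mu x) (v x))
    (pairing dmu (v s) + pairing (mu s) dv).
Proof.
move=> /is_derive_mxP dmuE /is_derive_mxP dvE.
rewrite (_ : (fun x => _) =
    \sum_(j < n) ((fun x => v x 0 j) * (fun x => mu x j 0))); last first.
  by apply/funext => x; rewrite pairingE fct_sumE.
rewrite !pairingE -big_split /=; apply: is_derive_sum => j.
by have := is_deriveM (dvE 0 j) (dmuE j 0); rewrite /GRing.scale /= [mu s j 0 * _]mulrC.
Qed.

Lemma cvg_pairing (T : Type) (F : set_system T) (FF : Filter F)
    (mu : T -> 'cV[R]_n) (v : T -> 'rV[R]_n) mu0 v0 :
  mu x @[x --> F] --> mu0 -> v x @[x --> F] --> v0 ->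
  pairing (mu x) (v x) @[x --> F] --> pairing mu0 v0.
Proof.
move=> cmu cv; rewrite pairingE.
under eq_fun do rewrite pairingE.
apply: cvg_big => [|j _]; first exact: add_continuous.
apply: cvgM.
  exact: (cvg_comp _ _ cv (@coord_continuous R 1 n 0 j v0)).
exact: (cvg_comp _ _ cmu (@coord_continuous R n 1 j 0 mu0)).
Qed.

End Pairing.

Section Coadjoint.
Context {R : realType} {n : nat} {G : lieGroupType R n}.
Implicit Types (xi eta : 'rV[R]_n) (mu : 'cV[R]_n).

Lemma pairing_Ad_dual (g : G) mu eta :
  pairing (Ad_dual g mu) eta = pairing mu (Ad g eta).
Proof.
by apply: pairing_covector => [u v|a u]; rewrite ?AdD ?AdZ ?pairingDr ?pairingZr.
Qed.

Lemma dAdD xi u v : dAd (G := G) xi (u + v) = dAd (G := G) xi u + dAd (G := G) xi v.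
Proof.
pose f eta (y : 'rV[R]_n) := Ad (cinv (chart_at (1%g : G)) y) eta.
have fD : f (u + v) = f u + f v by apply/funext => y; exact: AdD.
have du : differentiable (f u) _ := Ad_chart_differentiable u.
have dv : differentiable (f v) _ := Ad_chart_differentiable v.
rewrite /dAd -/(f u) -/(f v) -/(f (u + v)) fD.
exact: (congr1 (@^~ xi) (diffD du dv)).
Qed.

Lemma dAdZ xi (a : R) v : dAd (G := G) xi (a *: v) = a *: dAd (G := G) xi v.
Proof.
pose f eta (y : 'rV[R]_n) := Ad (cinv (chart_at (1%g : G)) y) eta.
have fZ : f (a *: v) = a *: f v by apply/funext => y; exact: AdZ.
have dv : differentiable (f v) _ := Ad_chart_differentiable v.
rewrite /dAd -/(f v) -/(f (a *: v)) fZ.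
exact: (congr1 (@^~ xi) (diffZ a dv)).
Qed.

(** A covector records values on the basis only, so linearity of [ad xi] is needed; it is inherited
    from that of [Ad] through [dAd]. *)
Lemma pairing_ad_dual xi mu eta :
  pairing (ad_dual (G := G) xi mu) eta = pairing mu (dAd (G := G) xi eta).
Proof.
rewrite -ad_dAd.
apply: (pairing_covector (f := fun eta => pairing mu (ad (G := G) xi eta))).
  by move=> u v; rewrite !ad_dAd dAdD pairingDr.
by move=> a u; rewrite !ad_dAd dAdZ pairingZr.
Qed.

Lemma coadjoint_conservation (g : R -> G) (mu : R -> 'cV[R]_n) (s : R) xi eta :
  rvelocity g s xi -> derivable mu s 1 ->
  derive1 mu s + ad_dual (G := G) xi (mu s) = 0 ->
  is_derive s 1 (fun x => pairing (mu x) (Ad (g x) eta)) 0.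
Proof.
move=> /(is_derive_Ad eta) dg /derivableP dmu E.
have := is_derive_pairing dmu dg.
by rewrite -pairing_ad_dual -pairingDl -derive1E E pairing0l.
Qed.

End Coadjoint.

Section EulerLagrange.
Context {R : realType} {n m : nat} {G : lieGroupType R n}
        {Q : manifoldType R m}.
Variables (act : G -> Q -> Q) (d : Q -> Q -> R) (k : nat)
  (ell : 'M[R]_(k, n) -> R) (sigma : R) (l : nat) (t : nat -> R) (Q0 : Q)
  (Qt : nat -> Q) (xi0 : nat -> 'rV[R]_n) (g : R -> G)
  (xi : nat -> R -> 'rV[R]_n) (mu : nat -> R -> 'cV[R]_n).
Hypothesis k_gt0 : (0 < k)%N.
Hypothesis t_incr : forall i, (i < l)%N -> t i < t i.+1.
Hypothesis sol : EL_solution act d ell sigma l t Q0 Qt xi0 g xi mu.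

Let F i := node_force act d sigma (act (g (t i)) Q0) (Qt i).
Let A eta x := pairing (mu 0%N x) (Ad (g x) eta).
(** The constant value of [A eta] on the [s]-th open interval, sampled at the midpoint. *)
Let C eta s := A eta ((t s + t s.+1) / 2).

Lemma node_time_le i j : (i <= j)%N -> (j <= l)%N -> t i <= t j.
Proof.
elim: j => [|j IH]; first by rewrite leqn0 => /eqP->.
rewrite leq_eqVlt => /predU1P[->//|]; rewrite ltnS => ij jl.
by apply: le_trans (IH ij (ltnW jl)) _; exact/ltW/t_incr.
Qed.

Lemma node_time_lt i j : (i < j)%N -> (j <= l)%N -> t i < t j.
Proof.
by case: j => // j ij jl; apply: le_lt_trans (t_incr jl); exact: node_time_le (ltnW jl).
Qed.

Lemma adjoint_momentum_constant eta s x : (s < l)%N -> t s < x < t s.+1 ->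
  A eta x = C eta s.
Proof.
move=> sl xs; apply: (@is_derive0_itvoo_constant _ _ (t s) (t s.+1)) => //; last first.
  by have := t_incr sl; lra.
move=> y ys; have [gc gd] := EL_g_C1 sol sl ys.
have [dg _] := gd _ (mem_chart_at (g y)).
have rg := rvelocity_chart gc (mem_chart_at (g y)) (derivableP dg).
have E2 := EL_I2 sol sl ys.
(* The target chart of (I2) is the one at [g y * (g y)^-1]; rewriting this to [1] turns (I2) into
   the velocity found in [rg]. *)
rewrite /tmap /velocity derive1E mulgV in E2.
rewrite [tloc _ _ _ _ _]E2 in rg.
apply: coadjoint_conservation rg _ (EL_I1 sol sl ys).
by have [] := EL_mu_C1 sol k_gt0 sl ys.
Qed.

(** Since [g] is continuous across the nodes, [Ad (g x) eta] has no jump there: only [mu] needs a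
    one-sided limit. *)
Lemma adjoint_momentum_left eta s : (s < l)%N ->
  pairing (lim (mu 0%N x @[x --> (t s.+1)^'-])) (Ad (g (t s.+1)) eta) = C eta s.
Proof.
move=> sl; have cmu := EL_mu_left sol k_gt0 (sl : (0 < s.+1 <= l)%N).
have cg : g x @[x --> (t s.+1)^'-] --> g (t s.+1).
  apply: within_itvcc_left (EL_g_cont sol) _.
  by rewrite node_time_lt//= node_time_le.
have cA : A eta x @[x --> (t s.+1)^'-] -->
    pairing (lim (mu 0%N x @[x --> (t s.+1)^'-])) (Ad (g (t s.+1)) eta).
  exact: (cvg_pairing _ cmu (cvg_comp _ _ cg (@Ad_continuous R n G _ eta))).
have nC : \forall x \near (t s.+1)^'-, C eta s = A eta x.
  near=> x; apply/esym/adjoint_momentum_constant => //.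
  by apply/andP; split; near: x; [exact: nbhs_left_gt (t_incr sl)|exact: nbhs_left_lt].
have cC : A eta x @[x --> (t s.+1)^'-] --> C eta s.
  exact: cvg_trans (near_eq_cvg nC) (cvg_cst (C eta s)).
exact: (cvg_unique (@norm_hausdorff R R) cA cC).
Unshelve. all: by end_near. Qed.

Lemma adjoint_momentum_right eta s : (s < l)%N ->
  pairing (lim (mu 0%N x @[x --> (t s)^'+])) (Ad (g (t s)) eta) = C eta s.
Proof.
move=> sl; have cmu := EL_mu_right sol k_gt0 sl.
have cg : g x @[x --> (t s)^'+] --> g (t s).
  apply: within_itvcc_right (EL_g_cont sol) _.
  by rewrite node_time_lt// andbT node_time_le// ltnW.
have cA : A eta x @[x --> (t s)^'+] -->
    pairing (lim (mu 0%N x @[x --> (t s)^'+])) (Ad (g (t s)) eta).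
  exact: (cvg_pairing _ cmu (cvg_comp _ _ cg (@Ad_continuous R n G _ eta))).
have nC : \forall x \near (t s)^'+, C eta s = A eta x.
  near=> x; apply/esym/adjoint_momentum_constant => //.
  by apply/andP; split; near: x; [exact: nbhs_right_gt|exact: nbhs_right_lt (t_incr sl)].
have cC : A eta x @[x --> (t s)^'+] --> C eta s.
  exact: cvg_trans (near_eq_cvg nC) (cvg_cst (C eta s)).
exact: (cvg_unique (@norm_hausdorff R R) cA cC).
Unshelve. all: by end_near. Qed.

Lemma adjoint_momentum_last eta : (0 < l)%N ->
  C eta l.-1 = - pairing (F l) (Ad (g (t l)) eta).
Proof.
move=> l0; have := @adjoint_momentum_left eta l.-1.
rewrite prednK// => /(_ (leqnn _)) <-.
rewrite -(EL_mu_end sol k_gt0) -pairingNl.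
by have /eqP := EL_N3 sol; rewrite addr_eq0 => /eqP ->.
Qed.

Lemma adjoint_momentum_sum eta s : (s < l)%N ->
  C eta s = - \sum_(s.+1 <= i < l.+1) pairing (F i) (Ad (g (t i)) eta).
Proof.
(* Descending induction on [s]: [p] counts the intervals to the right of the [s]-th one. *)
move=> sl; have [p] : exists p, p = (l.-1 - s)%N by exists (l.-1 - s)%N.
elim: p s sl => [|p IH] s sl ps.
  have sE : s = l.-1 by lia.
  rewrite sE adjoint_momentum_last; last by lia.
  by rewrite prednK ?big_nat1//; lia.
have s1l : (s.+1 < l)%N by lia.
have := IH s.+1 s1l; rewrite -(adjoint_momentum_left eta sl).
rewrite -(adjoint_momentum_right eta s1l) => E.
have N1 := EL_N1 sol (s1l : (0 < s.+1 < l)%N).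
(* The right limit is the left limit plus the force, so crossing node [s.+1] leftwards subtracts its
   term. *)
move/eqP : N1; rewrite addrAC subr_eq0 => /eqP N1.
rewrite big_ltn; last by lia.
rewrite opprD -E; last by lia.
by rewrite -N1 pairingDl addrCA addNr addr0.
Qed.

Lemma adjoint_momentum_nodes x eta : (0 < l)%N ->
  (exists2 s, (s < l)%N & t s < x < t s.+1) \/ x = t 0%N \/ x = t l ->
  A eta x = - \sum_(1 <= i < l.+1)
    (x <= t i)%R%:R * pairing (F i) (Ad (g (t i)) eta).
Proof.
move=> l0 xr.
(* The indicator selects the nodes after the [s]-th interval. The endpoints belong to the first and
   last intervals; at [x = t l] the non-strict inequality keeps the term [i = l]. *)
have [s [sl -> lex gtx]] : exists s, [/\ (s < l)%N, A eta x = C eta s,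
    forall i, (s < i <= l)%N -> x <= t i & forall i, (0 < i <= s)%N -> t i < x].
  case: xr => [[s sl sx]|[->|->]].
  - exists s; split=> [||i /andP[si il]|i /andP[i0 is_]]; first exact: sl.
    + exact: adjoint_momentum_constant.
    + case/andP: sx => _ /ltW xs; apply: le_trans xs _; exact: node_time_le.
    + case/andP: sx => sx _; apply: le_lt_trans sx; apply: node_time_le => //.
      exact: ltnW.
  - exists 0%N; split=> [||i /andP[_ il]|i il]; first exact: l0.
    + by rewrite -(adjoint_momentum_right eta l0) -(EL_mu_start sol k_gt0).
    + exact: node_time_le.
    + by lia.
  - exists l.-1; split=> [||i il|i il]; first by rewrite prednK.
    + rewrite /A adjoint_momentum_last//.
      have /eqP := EL_N3 sol; rewrite addr_eq0 => /eqP ->.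
      by rewrite pairingNl.
    + by rewrite (_ : i = l)//; lia.
    + by apply: node_time_lt => //; lia.
rewrite adjoint_momentum_sum//; congr (- _).
rewrite [RHS](@big_cat_nat _ _ _ s.+1)//=; last exact: ltnW.
rewrite [X in _ = X + _]big_nat_cond [X in _ = X + _]big1 => [|i]; last first.
  by rewrite andbT => iS; rewrite leNgt gtx ?mul0r.
rewrite add0r; apply: eq_big_nat => i iS.
by rewrite lex ?mul1r.
Qed.

End EulerLagrange.

Theorem theorem2p2 (R : realType) (n m : nat) (G : lieGroupType R n)
  (Q : manifoldType R m) (act : G -> Q -> Q)
  (act_smooth : smooth_left_action act)
  (d : Q -> Q -> R) (d_dist : is_distance d)
  (k : nat) (k_gt0 : (0 < k)%N)
  (ell : 'M[R]_(k, n) -> R)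
  (ell_smooth : smooth_on setT (ell : 'M[R]_(k, n) -> R^o))
  (sigma : R) (sigma_gt0 : 0 < sigma)
  (l : nat) (l_gt0 : (0 < l)%N)
  (t : nat -> R) (t_0 : t 0%N = 0)
  (t_incr : forall i, (i < l)%N -> t i < t i.+1)
  (Q0 : Q) (Qt : nat -> Q) (xi0 : nat -> 'rV[R]_n)
  (g : R -> G) (xi : nat -> R -> 'rV[R]_n) (mu : nat -> R -> 'cV[R]_n)
  (d_diff : forall i, (0 < i <= l)%N ->
     dist_differentiable d (act (g (t i)) Q0) (Qt i))
  (sol : EL_solution act d ell sigma l t Q0 Qt xi0 g xi mu)
  (x : R)
  (x_range : (exists2 s, (s < l)%N & t s < x < t s.+1) \/ x = 0 \/ x = t l) :
  mu 0%N x =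
    - (sigma ^- 2 *: Ad_dual (g x)^-1%g
        (\sum_(1 <= i < l.+1)
           (x <= t i)%R%:R *:
           Ad_dual (g (t i))
             (momentum act (act (g (t i)) Q0)
                (dist_d1dist d (act (g (t i)) Q0) (Qt i))))).
Proof.
(* Writing the test vector [v] as [Ad (g x)] of [Ad (g x)^-1 v] brings in the conserved pairing, and
   is the source of the outer [Ad_dual (g x)^-1]. *)
apply: pairing_inj => v; rewrite -{1}[v](AdK (g x)).
rewrite (adjoint_momentum_nodes k_gt0 t_incr sol _ l_gt0); last by rewrite t_0.
rewrite pairingNl pairingZl pairing_Ad_dual pairing_suml mulr_sumr.
congr (- _); apply: eq_bigr => i _.
by rewrite !pairingZl pairing_Ad_dual mulrCA.
Qed.
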